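(* Let $\mathbb{F}$ be a finite field and $k$ a constant. Every infinite sequence $\mathcal M_1,\mathcal M_2,\ldots$ of $\mathbb{F}$-representable delta-matroids of branch-width at most $k$ has a pair $i<j$ such that $\mathcal M_i$ is isomorphic to a minor of $\mathcal M_j$.
   Context: A delta-matroid is a pair $(V,\mathcal F)$ of a finite set $V$ and a nonempty collection $\mathcal F$ of subsets of $V$ (feasible sets) such that if $F,F'\in\mathcal F$ and $x\in F\Delta F'$ then there exists $y\in F\Delta F'$ with $F\Delta\{x,y\}\in\mathcal F$. Twisting: $\mathcal M\Delta X=(V,\{F\Delta X:F\in\mathcal F\})$. Deletion: $\mathcal M\setminus X=(V\setminus X,\{F\subseteq V\setminus X: F\in\mathcal F\})$ (when nonempty). A minor of $\mathcal M$ is a delta-matroid obtained from $\mathcal M$ by twisting and/or deletion; two delta-matroids $\mathcal M_1=(V,\mathcal F_1)$, $\mathcal M_2=(V,\mathcal F_2)$ are equivalent if $\mathcal M_1=\mathcal M_2\Delta X$ for some $X\subseteq V$. Isomorphism of delta-matroids is a bijection of ground sets mapping feasible sets onto feasible sets. A $V\times V$ matrix is skew-symmetric if $A=-A^t$ with all diagonal entries zero, symmetric if $A=A^t$. For a skew-symmetric or symmetric $V\times V$ matrix $A$ over $\mathbb{F}$, $\mathcal M(A)=(V,\{X\subseteq V: A[X]\text{ nonsingular}\})$ (with $A[\emptyset]$ nonsingular) is a delta-matroid; a delta-matroid is $\mathbb{F}$-representable if it is equivalent to $\mathcal M(A)$ for some such $A$, and then $A$ is said to represent it. The rank-width of a $V\times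 V$ matrix $A$: minimize, over trees $T$ of maximum degree $\le3$ with a bijection $\mathcal L$ from $V$ to the leaves, the maximum over edges $e$ (splitting leaves into $(X_e,Y_e)$) of $\operatorname{rk}A[\mathcal L^{-1}(X_e),\mathcal L^{-1}(Y_e)]$ ($0$ if $|V|\le 1$). The branch-width of an $\mathbb{F}$-representable delta-matroid is the minimum rank-width of all skew-symmetric or symmetric matrices over $\mathbb{F}$ representing it. *)

(* Defs.v *)
From HB Require Import structures.
From mathcomp Require Import all_boot all_order all_algebra.

Set Implicit Arguments.
Unset Strict Implicit.
Unset Printing Implicit Defensive.

Definition symdiff (V : finType) (X Y : {set V}) : {set V} :=
  (X :\: Y) :|: (Y :\: X).

(* A delta-matroid (V, Fs) is given by its family Fs of feasible sets, the
   ground set being the carrier of the finite type V. *)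
Definition delta_matroid (V : finType) (Fs : {set {set V}}) : Prop :=
  Fs != set0 /\
  {in Fs &, forall X Y x, x \in symdiff X Y ->
     exists2 y, y \in symdiff X Y & symdiff X [set x; y] \in Fs}.

Definition twist (V : finType) (Fs : {set {set V}}) (X : {set V}) :
    {set {set V}} :=
  [set symdiff Y X | Y in Fs].

(* The ground set V \ X of the deletion is the subtype {x : V | x \notin X}. *)
Definition deletion (V : finType) (Fs : {set {set V}}) (X : {set V}) :
    {set {set {x : V | x \notin X}}} :=
  [set Y : {set {x : V | x \notin X}} | val @: Y \in Fs].

(* minor Fs Gs: Gs is obtained from Fs by finitely many twists and deletions. *)
Inductive minor (V : finType) (Fs : {set {set V}}) :
    forall U : finType, {set {set U}} -> Prop :=
  | minor_refl : minor Fs Fs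
  | minor_twist (U : finType) (Gs : {set {set U}}) (X : {set U}) :
      minor Fs Gs -> minor Fs (twist Gs X)
  | minor_deletion (U : finType) (Gs : {set {set U}}) (X : {set U}) :
      minor Fs Gs -> deletion Gs X != set0 -> minor Fs (deletion Gs X).

Definition equivalent (V : finType) (Fs Gs : {set {set V}}) : Prop :=
  exists X : {set V}, Fs = twist Gs X.

Definition isomorphic (V U : finType) (Fs : {set {set V}}) (Gs : {set {set U}}) :
    Prop :=
  exists2 f : V -> U, bijective f &
    forall X : {set V}, (f @: X \in Gs) = (X \in Fs).

(* A V x V matrix over F is a function V -> V -> F; its submatrices A[X, Y] are
   turned into library matrices through the enumerations of X and Y. *)
Definition submatrix (F : fieldType) (V : finType) (A : V -> V -> F)
    (X Y : {set V}) : 'M[F]_(#|X|, #|Y|) :=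
  \matrix_(i < #|X|, j < #|Y|) A (enum_val i) (enum_val j).

Definition skew_symmetric (F : fieldType) (V : finType) (A : V -> V -> F) :
    Prop :=
  (forall x y, A x y = - A y x)%R /\ (forall x, A x x = 0%R).

Definition symmetric_matrix (F : fieldType) (V : finType) (A : V -> V -> F) :
    Prop :=
  forall x y, A x y = A y x.

Definition matrix_feasible (F : fieldType) (V : finType) (A : V -> V -> F) :
    {set {set V}} :=
  [set X : {set V} | submatrix A X X \in unitmx].

Definition represents (F : fieldType) (V : finType) (A : V -> V -> F)
    (Fs : {set {set V}}) : Prop :=
  (skew_symmetric A \/ symmetric_matrix A) /\ equivalent Fs (matrix_feasible A).

Definition representable (F : fieldType) (V : finType) (Fs : {set {set V}}) :
    Prop :=
  exists A : V -> V -> F, represents A Fs.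

Definition degree (N : finType) (e : rel N) (t : N) : nat := #|[set s | e t s]|.

Definition is_tree (N : finType) (e : rel N) : Prop :=
  [/\ 0 < #|N|, symmetric e, irreflexive e, (forall s t, connect e s t)
    & forall c : seq N, ucycle e c -> size c <= 2].

Record rank_decomposition (V : finType) := RankDecomposition {
  node : finType;
  edge : rel node;
  leaf : V -> node;
  edge_tree : is_tree edge;
  edge_subcubic : forall t, degree edge t <= 3;
  leaf_inj : injective leaf;
  leaf_onto : forall t, (t \in codom leaf) = (degree edge t == 1) }.

Definition remove_edge (N : finType) (e : rel N) (s t : N) : rel N :=
  [rel x y | e x y && ([set x; y] != [set s; t])].

(* The elements of V whose leaf lies on the side of s once the edge {s, t} is
   removed. *)
Definition edge_side (V : finType) (D : rank_decomposition V) (s t : node D) :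
    {set V} :=
  [set v | connect (remove_edge (@edge V D) s t) s (leaf D v)].

(* Each edge is counted in both orientations; for skew-symmetric or symmetric A
   these give the same rank. *)
Definition decomposition_width (F : fieldType) (V : finType) (A : V -> V -> F)
    (D : rank_decomposition V) : nat :=
  \max_(p : node D * node D | edge p.1 p.2)
     \rank (submatrix A (edge_side p.1 p.2) (edge_side p.2 p.1)).

Definition is_minimum (P : nat -> Prop) (m : nat) : Prop :=
  P m /\ forall n, P n -> m <= n.

(* rank_width A w: the rank-width of A is w. *)
Definition rank_width (F : fieldType) (V : finType) (A : V -> V -> F) (w : nat) :
    Prop :=
  if #|V| <= 1 then w = 0
  else is_minimum
         (fun n => exists D : rank_decomposition V, decomposition_width A D = n) w.

(* branch_width F Fs w: the branch-width of (V, Fs), with respect to F, is w. *)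
Definition branch_width (F : fieldType) (V : finType) (Fs : {set {set V}})
    (w : nat) : Prop :=
  is_minimum
    (fun n => exists2 A : V -> V -> F, represents A Fs & rank_width A n) w.

(* Main.v *)
Require Import Defs.
From HB Require Import structures.
From mathcomp Require Import all_boot all_order all_algebra.
From mathcomp Require Import boolp zify ring.

(** A symmetric or skew-symmetric matrix [A] over [F] is replaced by the space
    [L] of all pairs [(x, x A)] in [(F^2)^V]; it is maximal isotropic for a form
    [f_1 g_2 + e f_2 g_1], twisting exchanges the two coordinates at an element,
    and deleting an element restricts to the chains whose second coordinate
    vanishes there. The rank of [A[X, V \ X]] is [|X| - dim L[X]], where [L[X]]
    is the space of members of [L] supported on [X].

    A part [X] of [V] is seen from outside only through the restrictions to [X]
    of members of [L], modulo [L[X]]. A part embeds in another one when some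
    minor of the latter induces a bijection of these finite quotients; gluing
    two parts is compatible with embeddings as soon as the gluing tables agree.

    As in Geelen, Gerards and Whittle, a branch decomposition can be chosen
    linked. If [Y] is below [X] with the same connectivity [r], and [r] is not
    undercut in between, Tutte's linking argument embeds [Y] in [X]. The lemma on
    trees of Robertson and Seymour then reduces well-quasi-ordering to gluing
    along increasing chains, where the pigeonhole principle applies. *)

Set Implicit Arguments.
Unset Strict Implicit.
Unset Printing Implicit Defensive.

Import GRing.Theory.

(** * Well-quasi-orders and trees *)

(** The scalar [e] of the form may change from one member of the sequence to another. This is
    harmless: embeddings mention no form, and isotropy is used inside one space at a time. The
    finiteness of the field is used for parts with at most one element and for the gluing tables;
    the width bound makes the induction on labels stop. The obstacle to linkedness is that cutting a
    tree along a small separation doubles nodes, which may increase the count of linked pairs at low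
    levels. A doubled node disappears at a higher level, so levels are compared lexicographically
    from the highest one down. A minor of a space always exists, whereas a deletion of a
    delta-matroid needs a feasible set. The return to delta-matroids therefore first changes the
    chosen coordinates, without changing the minor, until restriction becomes injective. *)

Section WellQuasiOrder.
Variables (E : Type) (le : E -> E -> Prop).

Definition good_seq (s : nat -> E) := exists i j, i < j /\ le (s i) (s j).

Definition wqo_on (P : E -> Prop) :=
  forall s : nat -> E, (forall n, P (s n)) -> good_seq s.

Lemma increasing_seq_lt (t : nat -> nat) :
  (forall n, t n < t n.+1) -> forall i j, i < j -> t i < t j.
Proof. by move=> tS i j; apply: (homo_ltn ltn_trans). Qed.

Lemma good_subseq (s : nat -> E) (t : nat -> nat) :
  (forall i j, i < j -> t i < t j) -> good_seq (s \o t) -> good_seq s.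
Proof. by move=> tP [i [j [ij le_ij]]]; exists (t i), (t j); split; [apply: tP|]. Qed.

Lemma increasing_choice (P : nat -> Prop) :
  (forall N, exists2 i, N <= i & P i) ->
  exists t : nat -> nat, (forall i j, i < j -> t i < t j) /\ forall n, P (t n).
Proof.
move=> infP.
have /choice[h hP] : forall N, exists i, N <= i /\ P i.
  by move=> N; have [i] := infP N; exists i.
pose t := fix t n := if n is n'.+1 then h (t n').+1 else h 0.
exists t; split; first by apply: increasing_seq_lt => n; case: (hP (t n).+1).
by case=> [|n]; [case: (hP 0) | case: (hP (t n).+1)].
Qed.

(** Applied twice in succession, this makes the left and the right children of a sequence of nodes
    increase together. *)
Lemma wqo_chain (P : E -> Prop) (s : nat -> E) :
    (forall x y z, le x y -> le y z -> le x z) ->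
    wqo_on P -> (forall n, P (s n)) ->
  exists t : nat -> nat, (forall i j, i < j -> t i < t j) /\
    forall i j, i < j -> le (s (t i)) (s (t j)).
Proof.
move=> le_tr wqoP Ps.
(* Terms with no larger later term are finitely many: infinitely many would form a bad sequence. *)
have [N NP] : exists N, forall i, N <= i -> exists j, i < j /\ le (s i) (s j).
  apply: contrapT => noN.
  have [|t [t_lt tP]] := @increasing_choice (fun i => forall j, i < j -> ~ le (s i) (s j)).
    move=> N; apply: contrapT => noi; apply: noN; exists N => i Ni.
    by apply: contrapT => noj; apply: noi; exists i => // j ij leij; apply: noj; exists j.
  have [i [j [ij]]] := wqoP (s \o t) (fun n => Ps _).
  exact: tP (t_lt _ _ ij).
have /choice[h hP] : forall i, exists j, N <= i -> i < j /\ le (s i) (s j).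
  move=> i; case: (leqP N i) => [/NP[j jP]|]; first by exists j.
  by exists 0.
pose t := fix t n := if n is n'.+1 then h (t n') else N.
have tN n : N <= t n.
  by elim: n => //= n IH; case: (hP _ IH) => /ltnW/(leq_trans IH).
exists t; split; first by apply: increasing_seq_lt => n; case: (hP _ (tN n)).
move=> i j; elim: j => // j IH; rewrite ltnS leq_eqVlt => /orP[/eqP->|ij].
  by case: (hP _ (tN j)).
by apply: le_tr (IH ij) _; case: (hP _ (tN j)).
Qed.

Lemma wqo_or (P Q : E -> Prop) :
  wqo_on P -> wqo_on Q -> wqo_on (fun x => P x \/ Q x).
Proof.
move=> wP wQ s PQ.
case: (EM (forall N, exists2 i, N <= i & P (s i))) => [/increasing_choice[t [tl tP]]|].
  by apply: good_subseq tl _; apply: wP.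
move=> noP; have [N NP] : exists N, forall i, N <= i -> Q (s i).
  apply: contrapT => noN; apply: noP => N; apply: contrapT => noi.
  apply: noN; exists N => i Ni; case: (PQ i) => // Pi.
  by case: noi; exists i.
have := wQ (fun i => s (N + i)) (fun i => NP _ (leq_addr _ _)).
by apply: good_subseq => i j; rewrite ltn_add2l.
Qed.

Lemma wqo_sub (P Q : E -> Prop) :
  (forall x, P x -> Q x) -> wqo_on Q -> wqo_on P.
Proof. by move=> PQ wQ s Ps; apply: wQ => n; apply: PQ. Qed.

Lemma nat_minimum (P : nat -> Prop) : (exists n, P n) ->
  exists2 n, P n & forall m, P m -> n <= m.
Proof.
case=> n; elim/ltn_ind: n => n IH Pn.
case: (EM (exists2 m, P m & m < n)) => [[m Pm mn]|no]; first exact: IH mn Pm.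
by exists n => // m Pm; rewrite leqNgt; apply/negP => mn; apply: no; exists m.
Qed.

Lemma ex_minimal (A : Type) (P : A -> Prop) (f : A -> nat) : (exists x, P x) ->
  exists2 x, P x & forall y, P y -> f x <= f y.
Proof.
move=> [x Px]; have [|n [y Py <-] min] := @nat_minimum (fun n => exists2 x, P x & f x = n).
  by exists (f x), x.
by exists y => // z Pz; apply: min; exists z.
Qed.

Definition bad_in (P : E -> Prop) (s : nat -> E) :=
  (forall n, P (s n)) /\ ~ good_seq s.

Lemma minimal_bad_seq (P : E -> Prop) (sz : E -> nat) : ~ wqo_on P ->
  exists m, bad_in P m /\
    forall n u, bad_in P u -> (forall i, i < n -> u i = m i) -> sz (m n) <= sz (u n).
Proof.
move=> nwqo; have [t0 bad0] : exists t, bad_in P t.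
  apply: contrapT => no; apply: nwqo => s Ps; apply: contrapT => bs.
  by apply: no; exists s.
have /choice[step stepP] : forall x : nat * (nat -> E), exists t', bad_in P x.2 ->
    [/\ bad_in P t', forall i, i < x.1 -> t' i = x.2 i &
     forall u, bad_in P u -> (forall i, i < x.1 -> u i = x.2 i) -> sz (t' x.1) <= sz (u x.1)].
  move=> [n t] /=; case: (EM (bad_in P t)) => [bt|]; last by exists t.
  have [|t' [bt' t't] min] := @ex_minimal _
      (fun u => bad_in P u /\ forall i, i < n -> u i = t i) (fun u => sz (u n)).
    by exists t.
  by exists t' => _; split=> // u bu ut; apply: min.
(* The first [n] terms of the bad sequence [T n] are final, so the diagonal [m] agrees with it
   there; a good pair [i < j] of [m] would be one of [T j.+1]. *)
pose T := fix T n := if n is n'.+1 then step (n', T n') else t0.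
have badT n : bad_in P (T n) by elim: n => //= n IH; case: (stepP (n, T n) IH).
have TS n i : i < n -> T n.+1 i = T n i.
  by move=> lt_in; case: (stepP (n, T n) (badT n)) => _ H _; apply: H.
pose m n := T n.+1 n.
have Tm n i : i < n -> T n i = m i.
  elim: n => // n IH; rewrite ltnS leq_eqVlt => /orP[/eqP->//|lt_in].
  by rewrite TS // IH.
exists m; split.
  split=> [n|[i [j [ij leij]]]]; first by case: (badT n.+1) => PT _; apply: PT.
  case: (badT j.+1) => _; apply; exists i, j; split=> //.
  by rewrite !Tm // ltnS ltnW.
move=> n u bu um; case: (stepP (n, T n) (badT n)) => _ _ /(_ u bu) min; apply: min.
by move=> i lt_in; rewrite /= um // Tm.
Qed.

End WellQuasiOrder.

(** * The lemma on trees, by minimal bad sequences *)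

Section TreeLemma.
Variables (E : Type) (le : E -> E -> Prop) (lab sz : E -> nat) (lc rc : E -> E).

Definition child (e f : E) := f = lc e \/ f = rc e.

(** Every node on the way, both ends included, lies in [S]; this is how [linked] bounds the labels
    between two edges from below. *)
Inductive descendant (S : E -> Prop) : E -> E -> Prop :=
| descendant_child e f : S e -> S f -> child e f -> descendant S e f
| descendant_step e f g :
    descendant S e f -> S g -> child f g -> descendant S e g.

Variables (inner : E -> Prop) (k : nat).
Hypothesis le_tr : forall x y z, le x y -> le y z -> le x z.
Hypothesis sz_child : forall e f, inner e -> child e f -> sz f < sz e.
Hypothesis lab_le : forall e, inner e -> lab e <= k.
Hypothesis linked : forall e f,
  descendant (fun g => inner g /\ lab e <= lab g) e f -> lab f = lab e -> le f e.
Hypothesis combine : forall s : nat -> E, (forall n, inner (s n)) ->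
  (forall i j, i < j -> le (lc (s i)) (lc (s j))) ->
  (forall i j, i < j -> le (rc (s i)) (rc (s j))) -> good_seq le s.

Lemma descendant_sub (S S' : E -> Prop) e f : (forall g, S g -> S' g) ->
  descendant S e f -> descendant S' e f.
Proof.
move=> SS'; elim=> [{}e {}f Se Sf c|{}e {}f g _ IH Sg c].
  by apply: descendant_child => //; apply: SS'.
by apply: descendant_step IH _ c; apply: SS'.
Qed.

Lemma descendant_end S e f : descendant S e f -> S f.
Proof. by case. Qed.

Lemma descendant_sz S e f : (forall g, S g -> inner g) ->
  descendant S e f -> sz f < sz e.
Proof.
move=> Si; elim=> [{}e {}f /Si Se _|{}e {}f g d IH _]; first exact: sz_child.
by move=> /(sz_child (Si _ (descendant_end d))) /ltn_trans; apply.
Qed.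

(* Downward induction on the least label [r] occurring in [S]. The edges of
   label [r] below a minimal bad sequence of such edges are well-quasi-ordered,
   so they join the base [B], and only labels above [r] remain inside. *)
Lemma wqo_on_forest n r (S B : E -> Prop) : k < r + n ->
    (forall e, S e -> inner e /\ r <= lab e) -> wqo_on le B ->
    (forall e f, S e -> child e f -> S f \/ B f) ->
  wqo_on le (fun e => S e \/ B e).
Proof.
elim: n r S B => [|n IH] r S B kr SP wB Sc.
  apply: wqo_sub wB => e [/SP[/lab_le le_k le_r]|//]; lia.
have Sin g : S g -> inner g by case/SP.
pose Sr e := S e /\ lab e = r.
have wSr : wqo_on le Sr; last first.
  apply: (@wqo_sub _ _ _ (fun e => (S e /\ r < lab e) \/ (Sr e \/ B e))).
    move=> e [Se|]; last by right; right.
    have [_] := SP _ Se; rewrite leq_eqVlt => /orP[/eqP|]; last by left.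
    by right; left.
  apply: (IH r.+1); [lia | by move=> e [/SP[]] | exact: wqo_or |].
  move=> e f [Se _] /(Sc _ _ Se)[Sf|]; last by right; right.
  have [_] := SP _ Sf; rewrite leq_eqVlt => /orP[/eqP|]; last by left.
  by right; left.
apply: contrapT => /(minimal_bad_seq sz)[m [[mP mbad] mmin]].
have le_desc e f : Sr e -> Sr f -> descendant S e f -> le f e.
  move=> [_ re] [_ rf] /descendant_sub d; apply: linked; last by rewrite re rf.
  by apply: d => g /SP[ig rg]; rewrite re.
(* A bad sequence [g] of [D], spliced after the terms [m i] with [i < a i0] for the least [a i0],
   would be a bad sequence with a smaller term at [a i0]. *)
pose D f := Sr f /\ exists n, descendant S (m n) f.
have wD : wqo_on le D.
  move=> g Dg; apply: contrapT => gbad.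
  have /choice[a aP] : forall i, exists n, descendant S (m n) (g i).
    by move=> i; case: (Dg i).
  have [|i0 _ imin] := @ex_minimal _ (fun=> True) a; first by exists 0.
  have := mmin (a i0) (fun i => if i < a i0 then m i else g (i0 + (i - a i0))).
  have : sz (g i0) < sz (m (a i0)) by apply: descendant_sz (aP i0).
  rewrite ltnn subnn addn0 => sz_lt min_m.
  suff bad_u : bad_in le Sr (fun i => if i < a i0 then m i else g (i0 + (i - a i0))).
    have agree i : i < a i0 -> (if i < a i0 then m i else g (i0 + (i - a i0))) = m i.
      by move=> ->.
    by have := min_m bad_u agree; rewrite leqNgt sz_lt.
  split=> [i|[i [j [ij]]]]; first by case: ifP => // _; case: (Dg (i0 + (i - a i0))).
  case: ltnP => [ai|ia]; case: ltnP => [aj|ja].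
  - by move=> leij; apply: mbad; exists i, j.
  (* Linkedness puts [g jj] below its ancestor [m (a jj)], and [i < a jj] by the choice of [i0]. *)
  - set jj := i0 + _ => leij; apply: mbad; exists i, (a jj); split.
      by apply: leq_trans ai (imin _ _).
    by apply: le_tr leij (le_desc _ _ _ _ _) => //; case: (Dg jj).
  - lia.
  - move=> leij; apply: gbad; exists (i0 + (i - a i0)), (i0 + (j - a i0)).
    split=> //; lia.
(* With [D] added to the base, a child of label [r] met below [m] falls into the base, and only
   larger labels recur. *)
have wC : wqo_on le (fun e => (S e /\ r < lab e /\ exists n, descendant S (m n) e) \/ (B e \/ D e)).
  apply: (IH r.+1); [lia | by move=> e [/SP[? _] [? _]] | exact: wqo_or |].
  move=> e f [Se [_ [i di]]] c; case: (Sc _ _ Se c) => [Sf|]; last by right; left.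
  have df : descendant S (m i) f by apply: descendant_step di _ c.
  have [_] := SP _ Sf; rewrite leq_eqVlt => /orP[/eqP rf|];
    last by left; split=> //; split=> //; exists i.
  by right; right; split; [|exists i].
have mC i f : child (m i) f -> (S f /\ r < lab f /\ exists n, descendant S (m n) f) \/ (B f \/ D f).
  move=> c; have [Sm _] := mP i; case: (Sc _ _ Sm c) => [Sf|]; last by right; left.
  have df : descendant S (m i) f by apply: descendant_child.
  have [_] := SP _ Sf; rewrite leq_eqVlt => /orP[/eqP rf|];
    last by left; split=> //; split=> //; exists i.
  by right; right; split; [|exists i].
have [t1 [t1_lt t1_le]] := wqo_chain le_tr wC (fun i => mC i _ (or_introl (erefl (lc (m i))))).
have [t2 [t2_lt t2_le]] :=
  wqo_chain le_tr wC (fun i => mC (t1 i) _ (or_intror (erefl (rc (m (t1 i)))))).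
apply: mbad; apply: (@good_subseq _ _ _ (t1 \o t2)); first by move=> i j ij; apply/t1_lt/t2_lt.
apply: combine => [i|i j ij|i j ij] /=; first by apply: Sin; case: (mP (t1 (t2 i))).
  exact/t1_le/t2_lt.
exact: t2_le.
Qed.

End TreeLemma.

(** * Linked decompositions *)

(** The most significant index is [n - 1]: the last function is minimized first and smaller indices
    break ties. *)
Lemma lex_minimal (A : Type) (P : nat -> A -> nat) n (Q : A -> Prop) :
    (exists x, Q x) ->
  exists2 x, Q x & forall y, Q y -> forall j, j < n ->
    (forall i, j < i < n -> P i y <= P i x) -> P j x <= P j y.
Proof.
elim: n Q => [|n IH] Q [x Qx]; first by exists x.
have [|x1 Qx1 min1] := @ex_minimal _ Q (P n); first by exists x.
have [|x2 [Qx2 eq2] min2] := IH (fun y => Q y /\ P n y = P n x1).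
  by exists x1.
exists x2 => // y Qy j; rewrite ltnS leq_eqVlt => /orP[/eqP-> _|lt_jn le_y].
  by rewrite eq2 min1.
apply: min2 => [||i /andP[ji lt_in]] //.
  split=> //; apply/eqP; rewrite eqn_leq min1 // -eq2 le_y //; lia.
by apply: le_y; lia.
Qed.

Lemma count_lt (T : eqType) (a b : pred T) (s : seq T) x :
    {in s, forall y, a y -> b y} -> x \in s -> b x -> ~~ a x ->
  count a s < count b s.
Proof.
move=> ab xs bx nax.
have : count a s + has (fun y => b y && ~~ a y) s <= count b s.
  elim: s ab {xs} => //= y s IH ab.
  have {}IH := IH (fun z zs => ab z (@mem_behead _ (y :: s) z zs)).
  have := ab y (mem_head _ _); move: IH.
  by case: (a y); case: (b y); case: (has _ s) => //= ? H; try lia; have := H isT.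
have -> : has (fun y => b y && ~~ a y) s by apply/hasP; exists x; rewrite ?bx.
by rewrite addn1.
Qed.

(** * Trees of subsets, contexts and restrictions *)

Section DecompositionTrees.
Variable V : finType.

(* Leaves may carry the empty set, so that restricting a tree to a subset keeps
   its shape. *)
Inductive dtree := DLeaf of {set V} | DNode of dtree & dtree.

Implicit Types (t : dtree) (X Y Z : {set V}) (D : seq (bool * dtree)).

Fixpoint dset t := match t with DLeaf A => A | DNode l r => dset l :|: dset r end.

Fixpoint dvalid t := match t with
  | DLeaf A => #|A| <= 1
  | DNode l r => [&& dvalid l, dvalid r & [disjoint dset l & dset r]]
  end.

Fixpoint dsets t := dset t ::
  match t with DLeaf _ => [::] | DNode l r => dsets l ++ dsets r end.

Fixpoint drestr Z t := match t with
  | DLeaf A => DLeaf (A :&: Z)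
  | DNode l r => DNode (drestr Z l) (drestr Z r)
  end.

(** A context lists the siblings met on the way down; the boolean says that the sibling is the left
    child. *)
Fixpoint plug D t := match D with
  | [::] => t
  | (b, h) :: D' => if b then DNode h (plug D' t) else DNode (plug D' t) h
  end.

Fixpoint path_sets D t := match D with
  | [::] => [:: dset t]
  | (b, h) :: D' => (dset h :|: dset (plug D' t)) :: path_sets D' t
  end.

Definition side_sets D := flatten [seq dsets p.2 | p <- D].

Definition crestr Z D := [seq (p.1, drestr Z p.2) | p <- D].

Lemma dset_drestr Z t : dset (drestr Z t) = dset t :&: Z.
Proof. by elim: t => //= l -> r ->; rewrite setIUl. Qed.

Lemma drestr_id Z t : dset t \subset Z -> drestr Z t = t.
Proof.
elim: t => [A|l IHl r IHr] /=; first by move/setIidPl->.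
by rewrite subUset => /andP[/IHl-> /IHr->].
Qed.

Lemma dsets_drestr Z t : dsets (drestr Z t) = [seq X :&: Z | X <- dsets t].
Proof. by elim: t => //= l -> r ->; rewrite !dset_drestr setIUl map_cat. Qed.

Lemma dvalid_drestr Z t : dvalid t -> dvalid (drestr Z t).
Proof.
elim: t => [A|l IHl r IHr] /=.
  by apply: leq_trans; apply/subset_leq_card/subsetIl.
case/and3P=> /IHl-> /IHr->; rewrite !dset_drestr /= => /disjointWl/disjointWr-> //;
  exact: subsetIl.
Qed.

Lemma dset_plug_cons b h D t :
  dset (plug ((b, h) :: D) t) = dset h :|: dset (plug D t).
Proof. by case: b => //=; rewrite setUC. Qed.

Lemma dvalid_plug_cons b h D t : dvalid (plug ((b, h) :: D) t) =
  [&& dvalid h, dvalid (plug D t) & [disjoint dset h & dset (plug D t)]].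
Proof. by case: b => //=; rewrite andbCA disjoint_sym. Qed.

Lemma side_sets_cons b h D : side_sets ((b, h) :: D) = dsets h ++ side_sets D.
Proof. by []. Qed.

Lemma crestr_cons Z b h D : crestr Z ((b, h) :: D) = (b, drestr Z h) :: crestr Z D.
Proof. by []. Qed.

Lemma drestr_plug Z D t : drestr Z (plug D t) = plug (crestr Z D) (drestr Z t).
Proof. by elim: D => //= [[[] h] D] /= <-. Qed.

Lemma all_dsets_plug a D t : all a (dsets (plug D t)) =
  [&& all a (path_sets D t), all a (side_sets D) & all a (dsets t)].
Proof.
elim: D => [|[b h] D IH] /=; first by case: t => *; rewrite /= ?andbT ?andbA ?andbb.
rewrite side_sets_cons all_cat -(andbA (a _)).
have -> : all a (dsets (if b then DNode h (plug D t) else DNode (plug D t) h)) =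
   [&& a (dset h :|: dset (plug D t)), all a (dsets h) & all a (dsets (plug D t))].
  by case: (b); rewrite /= all_cat // setUC (andbC (all a (dsets (plug D t)))).
rewrite IH; do 2!bool_congr.
Qed.

Lemma path_sets_eq D t t' : dset t = dset t' -> path_sets D t = path_sets D t' /\
  dset (plug D t) = dset (plug D t').
Proof.
by move=> eqt; elim: D => [|[b h] D [/= -> eqD]]; rewrite ?dset_plug_cons /= ?eqt ?eqD.
Qed.

Lemma dvalid_plug D t t' : dset t = dset t' -> dvalid t' ->
  dvalid (plug D t) -> dvalid (plug D t').
Proof.
move=> eqt vt'; elim: D => // -[b h] D IH; rewrite !dvalid_plug_cons.
by case: (path_sets_eq D eqt) => _ <- /and3P[-> /IH-> ->].
Qed.

Lemma dvalid_plugr D t : dvalid (plug D t) -> dvalid t.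
Proof. by elim: D => // -[b h] D IH; rewrite dvalid_plug_cons => /and3P[_ /IH]. Qed.

Lemma dset_plug_sub D t : dset t \subset dset (plug D t).
Proof.
elim: D => // -[b h] D IH; rewrite dset_plug_cons.
exact: subset_trans IH (subsetUr _ _).
Qed.

Lemma dsets_sub t X : X \in dsets t -> X \subset dset t.
Proof.
elim: t => [A|l IHl r IHr] /=; first by rewrite inE => /eqP->.
rewrite inE mem_cat => /or3P[/eqP->//|/IHl|/IHr] /subset_trans; apply.
  exact: subsetUl.
exact: subsetUr.
Qed.

Lemma path_sets_between D t X : X \in path_sets D t ->
  (dset t \subset X) && (X \subset dset (plug D t)).
Proof.
elim: D => [|[b h] D IH]; first by rewrite inE => /eqP->; rewrite subxx.
rewrite /= inE => /orP[/eqP->|/IH/andP[-> XD]].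
  rewrite (subset_trans (dset_plug_sub D t) (subsetUr _ _)) /=.
  by rewrite -(dset_plug_cons b) subxx.
by rewrite -/(plug ((b, h) :: D) t) dset_plug_cons (subset_trans XD (subsetUr _ _)).
Qed.

Lemma side_sets_props D t X : dvalid (plug D t) -> X \in side_sets D ->
  (X \subset dset (plug D t)) && [disjoint X & dset t].
Proof.
elim: D => // -[b h] D IH; rewrite dvalid_plug_cons => /and3P[_ vD dis].
rewrite side_sets_cons mem_cat dset_plug_cons => /orP[/dsets_sub Xh|/(IH vD)/andP[XD ->]].
  rewrite (subset_trans Xh (subsetUl _ _)) /=.
  exact: disjointWl Xh (disjointWr (dset_plug_sub D t) dis).
by rewrite (subset_trans XD (subsetUr _ _)).
Qed.

Definition nested (X Y : {set V}) := [|| [disjoint X & Y], X \subset Y | Y \subset X].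

Lemma nested_sym X Y : nested X Y = nested Y X.
Proof. by rewrite /nested disjoint_sym; congr (_ || _); rewrite orbC. Qed.

Lemma disjoint_nested (A B X Y : {set V}) : [disjoint A & B] -> X \subset A -> Y \subset B ->
  nested X Y.
Proof.
by move=> dis XA YB; apply/orP; left; apply: disjointWl XA (disjointWr YB dis).
Qed.

Lemma dsets_nested t X Y : dvalid t -> X \in dsets t -> Y \in dsets t -> nested X Y.
Proof.
elim: t => [A|l IHl r IHr] /=.
  by rewrite !inE => _ /eqP-> /eqP->; rewrite /nested subxx !orbT.
case/and3P=> vl vr dis; rewrite -(cat_cons _ (dsets l)) !mem_cat !inE -!orbA.
have sl A : A \in dsets l -> A \subset dset l :|: dset r.
  by move/dsets_sub/subset_trans; apply; apply: subsetUl.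
have sr A : A \in dsets r -> A \subset dset l :|: dset r.
  by move/dsets_sub/subset_trans; apply; apply: subsetUr.
case/or3P=> [/eqP->|Xl|Xr] /or3P[/eqP->|Yl|Yr].
- by rewrite /nested subxx !orbT.
- by rewrite /nested sl ?orbT ?orbT.
- by rewrite /nested sr ?orbT ?orbT.
- by rewrite /nested sl ?orbT ?orbT.
- exact: IHl.
- exact: disjoint_nested dis (dsets_sub Xl) (dsets_sub Yr).
- by rewrite /nested sr ?orbT ?orbT.
- by rewrite nested_sym; apply: disjoint_nested dis (dsets_sub Yl) (dsets_sub Xr).
- exact: IHr.
Qed.

Lemma side_sets_nested D t X Y : dvalid (plug D t) ->
  X \in side_sets D -> Y \in side_sets D -> nested X Y.
Proof.
elim: D => // -[b h] D IH; rewrite dvalid_plug_cons => /and3P[vh vD dis].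
have sD A : A \in side_sets D -> A \subset dset (plug D t).
  by move/(side_sets_props vD)/andP=> [].
rewrite side_sets_cons !mem_cat => /orP[Xh|XD] /orP[Yh|YD].
- exact: dsets_nested vh Xh Yh.
- exact: disjoint_nested dis (dsets_sub Xh) (sD _ YD).
- by rewrite nested_sym; apply: disjoint_nested dis (dsets_sub Yh) (sD _ XD).
- exact: IH.
Qed.

(** What the siblings lose to [Z] is already present in [t'] at the end of the path. *)
Lemma path_sets_crestr Z D t t' : dset t' = dset t :|: Z ->
  path_sets (crestr (~: Z) D) t' = [seq X :|: Z | X <- path_sets D t] /\
  dset (plug (crestr (~: Z) D) t') = dset (plug D t) :|: Z.
Proof.
move=> eqt; elim: D => [|[b h] D [/= -> eqD]]; first by rewrite /= eqt.
have eqh : dset (drestr (~: Z) h) :|: (dset (plug D t) :|: Z) =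
    dset h :|: dset (plug D t) :|: Z.
  apply/setP=> x; rewrite dset_drestr !inE.
  by case: (x \in Z); case: (x \in dset h); case: (x \in dset _).
rewrite -/(plug ((b, drestr (~: Z) h) :: crestr (~: Z) D) t').
by rewrite -/(plug ((b, h) :: D) t) !dset_plug_cons eqD eqh.
Qed.

Lemma side_sets_crestr Z D : side_sets (crestr Z D) = [seq X :&: Z | X <- side_sets D].
Proof.
by elim: D => // -[b h] D IH; rewrite /= !side_sets_cons map_cat dsets_drestr IH.
Qed.

Lemma dvalid_crestr Z D t t' : dset t' = dset t :|: Z -> dvalid t' ->
  dvalid (plug D t) -> dvalid (plug (crestr (~: Z) D) t').
Proof.
move=> eqt vt'; elim: D => // -[b h] D IH; rewrite /= -/(plug ((b, h) :: D) t).
rewrite -/(plug ((b, drestr (~: Z) h) :: crestr (~: Z) D) t') !dvalid_plug_cons.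
case/and3P=> vh /IH-> dis; rewrite dvalid_drestr //=.
case: (path_sets_crestr D eqt) => _ ->; rewrite dset_drestr disjoint_subset.
apply/subsetP=> x; rewrite !inE => /andP[xh xZ]; rewrite (negPf xZ) orbF.
by rewrite (disjointFr dis xh).
Qed.

(** * The exchange argument that produces linked trees *)

Section Linking.
Variable lam : {set V} -> nat.
Hypothesis lam0 : lam set0 = 0.
Hypothesis lamC : forall X, lam (~: X) = lam X.
Hypothesis lam_submod : forall X Y,
  lam (X :&: Y) + lam (X :|: Y) <= lam X + lam Y.

Lemma lam_posimod X Y : lam (X :&: ~: Y) + lam (Y :\: X) <= lam X + lam Y.
Proof.
have := lam_submod X (~: Y); rewrite lamC -(lamC (X :|: _)).
by rewrite setCU setCK (setIC (~: X)) -(setDE Y).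
Qed.

Section Level.
Variable j : nat.

(* [top_size t] counts the nodes joined to the root through nodes of value at
   least [j], so [link_size] counts the pairs of nodes linked at level [j]. *)
Fixpoint top_size t := match t with
  | DLeaf A => (j <= lam A) : nat
  | DNode l r =>
      if j <= lam (dset l :|: dset r) then (top_size l + top_size r).+1 else 0
  end.

Fixpoint link_size t := top_size t +
  match t with DLeaf A => 0 | DNode l r => link_size l + link_size r end.

Lemma top_size_plug_cons b h D t : top_size (plug ((b, h) :: D) t) =
  if j <= lam (dset h :|: dset (plug D t))
  then (top_size h + top_size (plug D t)).+1 else 0.
Proof. by case: b => //=; rewrite setUC addnC. Qed.

Lemma link_size_plug_cons b h D t : link_size (plug ((b, h) :: D) t) =
  top_size (plug ((b, h) :: D) t) + (link_size h + link_size (plug D t)).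
Proof. by case: b => //=; congr (_ + _); rewrite addnC. Qed.

(** A node of value [x] gets two copies: one of value [o] in the outer tree, one of value [i] in the
    tree moved inside [Z]. Domination lets at most one copy be visible at level [j], and only if the
    node was; a [lost] node leaves no visible copy, which is a source of strict decrease. *)
Definition dominated (x o i : nat) := [&& o <= x, i <= x & ~~ ((j <= o) && (j <= i))].

Definition lost (x o i : nat) := [&& j <= x, o < j & i < j].

Definition side_dom Z X := dominated (lam X) (lam (X :&: ~: Z)) (lam (X :&: Z)).
Definition side_lost Z X := lost (lam X) (lam (X :&: ~: Z)) (lam (X :&: Z)).
Definition path_dom Z X := dominated (lam X) (lam (X :|: Z)) (lam (X :&: Z)).
Definition path_lost Z X := lost (lam X) (lam (X :|: Z)) (lam (X :&: Z)).

Lemma lost_nat x o i : dominated x o i -> (j <= o) + (j <= i) + lost x o i <= (j <= x).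
Proof.
by rewrite /dominated /lost; case: (leqP j x); case: (leqP j o); case: (leqP j i) => *; lia.
Qed.

Lemma top_size_restr Z t : all (side_dom Z) (dsets t) ->
  top_size (drestr (~: Z) t) + top_size (drestr Z t) + side_lost Z (dset t) <= top_size t.
Proof.
elim: t => [A|l IHl r IHr] /=.
  by rewrite andbT => /lost_nat.
rewrite all_cat => /and3P[/lost_nat + /IHl {}IHl /IHr {}IHr].
rewrite -/(side_lost Z _) !dset_drestr -!setIUl.
case: (leqP j (lam (dset l :|: dset r))) => _;
  case: (leqP j (lam (_ :&: ~: Z))) => _; case: (leqP j (lam (_ :&: Z))) => _; lia.
Qed.

Lemma link_size_restr Z t : all (side_dom Z) (dsets t) ->
  link_size (drestr (~: Z) t) + link_size (drestr Z t) + has (side_lost Z) (dsets t)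
    <= link_size t.
Proof.
elim: t => [A|l IHl r IHr] dom; have := top_size_restr dom.
  by rewrite /= orbF !addn0.
move: dom; rewrite /= all_cat has_cat => /and3P[_ /IHl {}IHl /IHr {}IHr].
move: IHl IHr; case: (side_lost _ _); case: (has _ (dsets l));
  case: (has _ (dsets r)) => /=; lia.
Qed.

Lemma path_lost_sub Z X : X \subset Z -> path_lost Z X = false.
Proof.
move=> XZ; rewrite /path_lost /lost (setIidPl XZ) (leqNgt j).
by case: (lam X < j); rewrite //= andbF.
Qed.

(** Outer copies of path nodes gain [Z] instead of losing it, since [t'] now ends the path. Being
    invisible at level [j], [t'] itself adds nothing that is reachable from above. *)
Lemma top_size_path Z D t t' :
    dset t' = dset t :|: Z -> top_size t' = 0 -> dset t \subset Z ->
    all (path_dom Z) (path_sets D t) -> all (side_dom Z) (side_sets D) ->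
  top_size (plug (crestr (~: Z) D) t') + top_size (drestr Z (plug D t))
    + path_lost Z (dset (plug D t)) <= top_size (plug D t).
Proof.
move=> eqt t'0 tZ; elim: D => [|[b h] D IH].
  by rewrite [plug _ _]/= t'0 drestr_id //= path_lost_sub // addn0.
rewrite side_sets_cons all_cat => /andP[/lost_nat + domD] /andP[domh /(IH domD) {}IH].
have := top_size_restr domh.
rewrite -/(path_lost Z _) drestr_plug !crestr_cons.
rewrite dset_plug_cons !top_size_plug_cons.
rewrite -(drestr_plug Z D) !dset_drestr -setIUl.
case: (path_sets_crestr D eqt) => _ ->.
have -> : dset h :&: ~: Z :|: (dset (plug D t) :|: Z) = dset h :|: dset (plug D t) :|: Z.
  apply/setP=> x; rewrite !inE.
  by case: (x \in Z); case: (x \in dset h); case: (x \in dset _).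
case: (leqP j (lam (dset h :|: dset (plug D t)))) => _;
  case: (leqP j (lam (_ :|: Z))) => _; case: (leqP j (lam (_ :&: Z))) => _; lia.
Qed.

(** The gain comes from [t], visible from the root along the path and replaced by the invisible
    [t']. *)
Lemma top_size_path_lt Z D t t' :
    dset t' = dset t :|: Z -> top_size t' = 0 -> dset t \subset Z ->
    all (fun X => j <= lam X) (path_sets D t) ->
    all (path_dom Z) (path_sets D t) -> all (side_dom Z) (side_sets D) ->
  top_size (plug (crestr (~: Z) D) t') < top_size (plug D t).
Proof.
move=> eqt t'0 tZ; elim: D => [|[b h] D IH].
  rewrite [plug _ _]/= t'0 /= andbT => jt _ _.
  by case: t jt {eqt tZ} => /= [A ->|l r ->].
rewrite side_sets_cons all_cat => /andP[jh jD] /andP[domt domD] /andP[domh /(IH jD domD) {}IH].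
have := top_size_restr domh.
rewrite [crestr _ _]/= !top_size_plug_cons jh.
by case: ifP => _; lia.
Qed.

(** In the application [t'] is the whole tree restricted to [Z], and its two contributions cancel.
    The induction along [D] needs [t'] fixed while the restricted tree grows. *)
Lemma link_size_path Z D t t' :
    dset t' = dset t :|: Z -> top_size t' = 0 -> dset t \subset Z ->
    all (path_dom Z) (path_sets D t) -> all (side_dom Z) (side_sets D) ->
  link_size (plug (crestr (~: Z) D) t') + link_size (drestr Z (plug D t))
    + (has (path_lost Z) (path_sets D t) || has (side_lost Z) (side_sets D))
   <= link_size (plug D t) + link_size t'.
Proof.
move=> eqt t'0 tZ; elim: D => [|[b h] D IH] dp ds.
  by rewrite [plug _ _]/= drestr_id //= path_lost_sub //= addn0 addnC.
have := top_size_path eqt t'0 tZ dp ds.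
move: dp ds; rewrite side_sets_cons all_cat => /andP[_ domD] /andP[domh /(IH domD) {}IH].
have := link_size_restr domh.
rewrite (drestr_plug Z (_ :: _)) !crestr_cons !link_size_plug_cons -(drestr_plug Z D).
rewrite has_cat [has (path_lost Z) _]/= dset_plug_cons.
move: IH; case: (path_lost _ _); case: (has (path_lost _) _);
  case: (has _ (dsets h)); case: (has _ (side_sets D)) => /=; lia.
Qed.

Lemma link_size_context C t t' : dset t' = dset t -> top_size t' <= top_size t ->
    link_size t' <= link_size t ->
  top_size (plug C t') <= top_size (plug C t) /\
  link_size (plug C t') + (link_size t - link_size t') <= link_size (plug C t).
Proof.
move=> eqt letop lel; elim: C => [|[b h] C [IH1 IH2]]; first by split=> //=; lia.
have le_top : top_size (plug ((b, h) :: C) t') <= top_size (plug ((b, h) :: C) t).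
  rewrite !top_size_plug_cons; case: (path_sets_eq C eqt) => _ ->.
  by case: ifP => // _; lia.
by split=> //; rewrite !link_size_plug_cons; lia.
Qed.

Lemma top_size0 t : lam (dset t) < j -> top_size t = 0.
Proof. by case: t => /= [A|l r]; rewrite ltnNge => /negPf->. Qed.

Lemma link_size_path_lt Z D t t' :
    dset t' = dset t :|: Z -> top_size t' = 0 -> dset t \subset Z ->
    all (fun X => j <= lam X) (path_sets D t) ->
    all (path_dom Z) (path_sets D t) -> all (side_dom Z) (side_sets D) ->
    lam (dset (plug D t) :&: Z) < j ->
  link_size (plug (crestr (~: Z) D) t') + link_size (drestr Z (plug D t))
    < link_size (plug D t) + link_size t'.
Proof.
move=> eqt t'0 tZ; case: D => [|[b h] D] jp dp ds lt_j.
  by move: jp lt_j; rewrite /= andbT (setIidPl tZ) leqNgt => /negPf->.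
have := top_size_path_lt eqt t'0 tZ jp dp ds.
have : top_size (drestr Z (plug ((b, h) :: D) t)) = 0.
  by rewrite top_size0 // dset_drestr.
move: dp ds; rewrite side_sets_cons all_cat => /andP[_ domD] /andP[domh domD'].
have := link_size_restr domh; have := link_size_path eqt t'0 tZ domD domD'.
rewrite (drestr_plug Z (_ :: _)) !crestr_cons !link_size_plug_cons -(drestr_plug Z D).
lia.
Qed.

End Level.

Definition splits Z X := (X :&: Z != set0) && (X :&: ~: Z != set0).

(** Here [Z'] stands for [X :|: Z] or [Z :\: X]: uncrossing with [X] splits no set of a laminar
    family that [Z] left whole. *)
Lemma splits_shrink Z Z' X Y : nested X Y -> splits Z X ->
    (forall x, x \notin X -> (x \in Z') = (x \in Z)) ->
    {in X &, forall x y, (x \in Z') = (y \in Z')} ->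
  splits Z' Y -> splits Z Y.
Proof.
move=> nst /andP[/set0Pn[a]] + /set0Pn[b] + eqZ homX /andP[/set0Pn[c]] + /set0Pn[d].
rewrite !inE => /andP[aX aZ] /andP[bX bZ] /andP[cY cZ] /andP[dY dZ].
case/or3P: nst => [dis|XY|YX].
- apply/andP; split; apply/set0Pn; [exists c|exists d]; rewrite !inE -eqZ ?cY ?dY //;
    by rewrite (disjointFl dis).
- apply/andP; split; apply/set0Pn; [exists a|exists b]; rewrite !inE ?aZ ?bZ andbT;
    exact: (subsetP XY).
- by move: dZ; rewrite -(homX c d) ?cZ // (subsetP YX).
Qed.

Lemma not_splits Z X : {in X &, forall x y, (x \in Z) = (y \in Z)} -> ~~ splits Z X.
Proof.
move=> homX; apply/negP => /andP[/set0Pn[a]] + /set0Pn[b].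
by rewrite !inE => /andP[aX aZ] /andP[bX]; rewrite -(homX a b) ?aZ.
Qed.

(** The subtree [t] is replaced by the whole tree restricted to an optimal separation [Z], and the
    siblings on the path lose [Z]. A strict decrease at [J] with no increase above it makes the new
    tree lexicographically smaller. *)
Lemma exchange_tree D t r Z0 : dvalid (plug D t) -> 0 < r ->
    all (fun X => r <= lam X) (path_sets D t) ->
    dset t \subset Z0 -> Z0 \subset dset (plug D t) -> lam Z0 < r ->
  exists t', [/\ dvalid t', dset t' = dset (plug D t),
    forall k, all (fun X => lam X <= k) (dsets (plug D t)) ->
      all (fun X => lam X <= k) (dsets t') &
    exists J, [/\ 0 < J, link_size J t' < link_size J (plug D t) & forall j, J <= j ->
      top_size j t' <= top_size j (plug D t) /\ link_size j t' <= link_size j (plug D t)]].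
Proof.
move=> vD r0 path_r tZ0 Z0D lamZ0.
pose between Z := (dset t \subset Z) && (Z \subset dset (plug D t)).
have [|Z1 bZ1 min1] := @ex_minimal _ between lam.
  by exists Z0; rewrite /between tZ0.
(* Among the cheapest separations, one splitting fewest sibling sets is taken: both copies of any
   set that it splits then have strictly smaller value, or uncrossing would give a better
   separation. *)
have [|Z [/andP[tZ ZD] minZ] minsplit] := @ex_minimal _
    (fun Z => between Z /\ forall Z', between Z' -> lam Z <= lam Z')
    (fun Z => count (splits Z) (side_sets D)).
  by exists Z1.
have lamZ : lam Z < r by apply: leq_ltn_trans lamZ0; apply: minZ; rewrite /between tZ0.
have side_between X : X \in side_sets D -> between (X :|: Z) && between (Z :\: X).
  move=> /(side_sets_props vD)/andP[XD dis]; rewrite /between subsetU ?tZ ?orbT //=.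
  rewrite subUset XD ZD /= (subset_trans (subsetDl _ _) ZD) andbT.
  by rewrite subsetD tZ disjoint_sym.
have side_le X : X \in side_sets D ->
    lam (X :&: ~: Z) <= lam X /\ lam (X :&: Z) <= lam X.
  move=> /side_between/andP[/minZ b1 /minZ b2].
  by have := lam_submod X Z; have := lam_posimod X Z; move: b1 b2; clear; lia.
have side_lt X : X \in side_sets D -> splits Z X ->
    lam (X :&: ~: Z) < lam X /\ lam (X :&: Z) < lam X.
  move=> Xs spX; have /andP[b1 b2] := side_between X Xs.
  have main Z' : between Z' -> (forall x, x \notin X -> (x \in Z') = (x \in Z)) ->
      {in X &, forall x y, (x \in Z') = (y \in Z')} -> lam Z < lam Z'.
    move=> bZ' eqZ homX; rewrite ltnNge; apply/negP => le_Z'.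
    have /minsplit : between Z' /\ forall Z'', between Z'' -> lam Z' <= lam Z''.
      by split=> // Z'' /minZ; apply: leq_trans.
    rewrite leqNgt => /negP; apply; apply: (count_lt (x := X)) => //; last exact: not_splits.
    move=> Y Ys; apply: splits_shrink eqZ homX => //.
    exact: side_sets_nested vD Xs Ys.
  have lt1 : lam Z < lam (X :|: Z).
    apply: main => // [x|x y xX yX]; rewrite !inE; first by move/negPf->.
    by rewrite xX yX.
  have lt2 : lam Z < lam (Z :\: X).
    apply: main => // [x|x y xX yX]; rewrite !inE; first by move=> ->.
    by rewrite xX yX.
  by have := lam_submod X Z; have := lam_posimod X Z; move: lt1 lt2; clear; lia.
have path_le X : X \in path_sets D t -> [/\ lam (X :|: Z) <= lam X, lam (X :&: Z) <= lam X
    & lam (X :|: Z) + lam (X :&: Z) <= lam X + lam Z].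
  move=> /path_sets_between/andP[tX XD].
  have /minZ : between (X :|: Z) by rewrite /between subsetU ?tX // subUset XD.
  have /minZ : between (X :&: Z).
    by rewrite /between subsetI tX tZ (subset_trans (subsetIl _ _)).
  by move: (lam_submod X Z); clear; split; lia.
pose te := plug D t; pose t' := plug (crestr (~: Z) D) (drestr Z te).
have eqI : dset (drestr Z te) = dset t :|: Z.
  by rewrite dset_drestr (setIidPr ZD) (setUidPr tZ).
have lamI : dset te :&: Z = Z by apply/setIidPr.
(* At a bad level some node has two visible copies, and the counts may grow. For [r <= j] both
   copies have value strictly below that of the node [X], which is therefore lost at the higher
   level [lam X]. *)
pose bad j := has (fun X => (j <= lam (X :&: ~: Z)) && (j <= lam (X :&: Z))) (side_sets D) ||
  has (fun X => (j <= lam (X :|: Z)) && (j <= lam (X :&: Z))) (path_sets D t).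
have dom j : ~~ bad j -> all (path_dom j Z) (path_sets D t) /\ all (side_dom j Z) (side_sets D).
  rewrite negb_or -!all_predC => /andP[/allP sd /allP pd]; split; apply/allP => X XD.
    by have := pd X XD; rewrite /path_dom /dominated /= => ->; case: (path_le X XD) => -> ->.
  by have := sd X XD; rewrite /side_dom /dominated /= => ->; case: (side_le X XD) => -> ->.
have topI j : r <= j -> top_size j (drestr Z te) = 0.
  by move=> rj; rewrite top_size0 // dset_drestr lamI (leq_trans lamZ).
have weak j : r <= j -> ~~ bad j ->
    top_size j t' <= top_size j te /\ link_size j t' <= link_size j te.
  move=> rj /dom[pd sd].
  have := top_size_path eqI (topI j rj) tZ pd sd; have := link_size_path eqI (topI j rj) tZ pd sd.
  by rewrite -/te -/t'; clear; lia.
have dt' : dset t' = dset te.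
  by case: (path_sets_crestr D eqI) => _ ->; apply/setUidPl.
exists t'; split=> //.
- exact: (dvalid_crestr eqI (dvalid_drestr Z vD) vD).
- move=> k; rewrite /t' !all_dsets_plug dsets_drestr side_sets_crestr.
  case: (path_sets_crestr D eqI) => -> _; rewrite !all_map => /and3P[kp ks kt].
  have kp' : all (fun X => (lam (X :|: Z) <= k) && (lam (X :&: Z) <= k)) (path_sets D t).
    apply/allP => X XD; have /= := allP kp X XD.
    by case: (path_le X XD) => l1 l2 _ /(leq_trans _) lek; rewrite !lek.
  have ks' : all (fun X => (lam (X :&: ~: Z) <= k) && (lam (X :&: Z) <= k)) (side_sets D).
    apply/allP => X XD; have /= := allP ks X XD.
    by case: (side_le X XD) => l1 l2 /(leq_trans _) lek; rewrite !lek.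
  apply/and3P; split.
  + by apply: sub_all kp' => X /andP[].
  + by apply: sub_all ks' => X /andP[].
  + rewrite (all_dsets_plug (preim (fun X => X :&: Z) (fun X => lam X <= k))).
    apply/and3P; split; [by apply: sub_all kp' => X /andP[] | by apply: sub_all ks' => X /andP[] |].
    apply/allP => X XD; rewrite /= (setIidPl (subset_trans (dsets_sub XD) tZ)).
    exact: (allP kt).
case: (EM (exists j, (r <= j) && bad j)) => [exbad|nobad]; last first.
  have good j : r <= j -> ~~ bad j.
    by move=> rj; apply/negP => bj; apply: nobad; exists j; rewrite rj.
  (* Without bad levels the decrease takes place at [r], where the path is visible and [Z] is
     not. *)
  exists r; split=> [||j rj] //; last exact: weak (good j rj).
  have [pd sd] := dom r (good r (leqnn r)).
  have := link_size_path_lt eqI (topI r (leqnn r)) tZ path_r pd sd.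
  by rewrite -/te lamI lamZ => /(_ isT); rewrite -/t'; clear; lia.
have bad_node j : r <= j -> bad j -> exists x, [/\ j < x &
    [|| has (path_lost x Z) (path_sets D t) | has (side_lost x Z) (side_sets D)]].
  move=> rj /orP[]/hasP[X XD /andP[j1 j2]]; exists (lam X).
    case: (boolP (splits Z X)) => [/(side_lt X XD)[l1 l2]|].
      split; first exact: leq_ltn_trans l2.
      by apply/orP; right; apply/hasP; exists X; rewrite // /side_lost /lost l1 l2 leqnn.
    rewrite negb_and !negbK => /orP[]/eqP eX0.
      by move: j2; rewrite eX0 lam0 leqNgt (leq_trans r0).
    by move: j1; rewrite eX0 lam0 leqNgt (leq_trans r0).
  have [l1 l2 l3] := path_le X XD.
  have [jX l4 l5] : [/\ j < lam X, lam (X :|: Z) < lam X & lam (X :&: Z) < lam X].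
    by move: l3 j1 j2 rj lamZ; clear; split; lia.
  split=> //; apply/orP; left; apply/hasP; exists X; rewrite // /path_lost /lost leqnn l4 l5 //.
have bad_le j : r <= j -> bad j -> j <= \max_(X : {set V}) lam X.
  move=> rj /orP[]/hasP[X XD /andP[_ j2]]; apply: leq_trans j2 _; exact: leq_bigmax.
(* Nothing grows above the highest bad level [m], and a node doubled at [m] is lost at some [J]
   above [m]. *)
have [m /andP[rm bm] maxm] := ex_maxnP exbad (fun j jP => bad_le j (andP jP).1 (andP jP).2).
have [J [mJ lostJ]] := bad_node m rm bm.
have good j : J <= j -> ~~ bad j.
  move=> Jj; apply/negP => bj;
  have : j <= m by apply: maxm; rewrite bj andbT; move: rm mJ Jj; clear; lia.
  by move: mJ Jj; clear; lia.
have rJ : r <= J by move: rm mJ; clear; lia.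
exists J; split=> [||j Jj]; first exact: leq_trans r0 rJ;
  last by apply: weak; [exact: leq_trans Jj|exact: good].
have [pd sd] := dom J (good J (leqnn J)).
have := link_size_path eqI (topI J rJ) tZ pd sd.
by rewrite lostJ -/te -/t'; clear; lia.
Qed.

Theorem linked_tree t0 k : dvalid t0 -> all (fun X => lam X <= k) (dsets t0) ->
  exists t, [/\ dvalid t, dset t = dset t0, all (fun X => lam X <= k) (dsets t) &
    forall C D tf, t = plug C (plug D tf) ->
      all (fun X => lam (dset tf) <= lam X) (path_sets D tf) ->
      forall Z, dset tf \subset Z -> Z \subset dset (plug D tf) -> lam (dset tf) <= lam Z].
Proof.
(* Values are at most [k], so [link_size] vanishes at all levels above [k], and the level [J] of an
   exchange is one of the [k.+1] levels compared. *)
move=> v0 w0; have [|t [vt dt wt] mint] := @lex_minimal _ link_size k.+1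
    (fun t => [/\ dvalid t, dset t = dset t0 & all (fun X => lam X <= k) (dsets t)]).
  by exists t0.
exists t; split=> // C D tf eqt path_r Z tZ ZD; rewrite leqNgt; apply/negP => lamZ.
have r0 : 0 < lam (dset tf) by lia.
have vD : dvalid (plug D tf) by apply: (@dvalid_plugr C); rewrite -eqt.
have [t' [vt' dt' wt' [J [J0 ltJ leJ]]]] := exchange_tree vD r0 path_r tZ ZD lamZ.
have valid' : [/\ dvalid (plug C t'), dset (plug C t') = dset t0 &
    all (fun X => lam X <= k) (dsets (plug C t'))].
  split; first by apply: dvalid_plug (esym dt') vt' _; rewrite -eqt.
    by case: (path_sets_eq C dt') => _ ->; rewrite -eqt.
  move: wt; rewrite eqt !all_dsets_plug; case: (path_sets_eq C dt') => -> _.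
  by case/and3P=> -> ->; rewrite -all_dsets_plug => /wt' ->.
have cmp j : J <= j -> link_size j (plug C t') +
    (link_size j (plug D tf) - link_size j t') <= link_size j (plug C (plug D tf)).
  by move=> /leJ[l1 l2]; case: (link_size_context C dt' l1 l2).
case: (leqP J k) => Jk.
  have := mint _ valid' J; rewrite ltnS Jk eqt => /(_ isT).
  have := cmp J (leqnn J) => cJ H.
  suff : link_size J (plug C (plug D tf)) <= link_size J (plug C t') by lia.
  by apply: H => i /andP[/ltnW/cmp]; lia.
have link0 s j : all (fun X => lam X <= k) (dsets s) -> k < j -> link_size j s = 0.
  move=> + kj; elim: s => [A|l IHl r IHr] /=; first by rewrite andbT => Ak; lia.
  by rewrite all_cat => /and3P[sk /IHl-> /IHr->]; rewrite addn0 leqNgt (leq_ltn_trans sk kj).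
by move: wt; rewrite eqt (all_dsets_plug _ C) => /and3P[_ _ w]; move: ltJ; rewrite (link0 _ J w).
Qed.

End Linking.
End DecompositionTrees.

(** * Rank decompositions as rooted binary trees *)

Section TreeComponents.
Variables (N : finType) (e : rel N).
Hypothesis tree_e : is_tree e.

Let esym : symmetric e. Proof. by case: tree_e. Qed.
Let eirr : irreflexive e. Proof. by case: tree_e. Qed.

Definition avoid s : rel N := [rel x y | [&& e x y, x != s & y != s]].

Lemma connect_avoid_sym s : connect_sym (avoid s).
Proof.
apply: sym_connect_sym => x y /=.
by rewrite /avoid /= esym; case: (x == s); case: (y == s); rewrite ?andbF.
Qed.

Lemma path_avoid s x p : path e x p -> s \notin x :: p -> path (avoid s) x p.
Proof.
elim: p x => //= y p IH x /andP[exy yp]; rewrite !inE !negb_or => /and3P[sx sy sp].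
by apply/andP; split; [rewrite /avoid /= exy ![_ == s]eq_sym sx | rewrite IH // inE negb_or sy].
Qed.

Lemma avoid_path_notin s x p : x != s -> path (avoid s) x p -> s \notin x :: p.
Proof.
elim: p x => [|y p IH] x xs /=; first by rewrite inE eq_sym xs.
by case/andP=> /and3P[_ _ ys] /(IH y ys) syp; rewrite inE negb_or eq_sym xs.
Qed.

Lemma sub_path_avoid s x p : path (avoid s) x p -> path e x p.
Proof. by apply: sub_path => y z /and3P[]. Qed.

Lemma connect_avoid_neq s x y : x != s -> connect (avoid s) x y -> y != s.
Proof.
move=> xs /connectP[p /(avoid_path_notin xs) sp ->].
by apply: contraNneq sp => <-; apply: mem_last.
Qed.

Lemma edge_neq u s : e u s -> u != s.
Proof. by apply: contraTneq => ->; rewrite eirr. Qed.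

(** A simple path from [u] reaching [s] without the edge would close up to a cycle of length at
    least three. Sides can thus be computed by removing a vertex, which suits the recursion over
    neighbours. *)
Lemma connect_remove_edge u s x : e u s ->
  connect (remove_edge e u s) u x = connect (avoid s) u x.
Proof.
move=> eus; apply/idP/idP.
  case/connectP=> p; case/shortenP=> q pq uq _ ->.
  have peq : path e u q by apply: sub_path pq => y z /andP[].
  apply/connectP; exists q => //; apply: path_avoid => //.
  rewrite inE negb_or eq_sym edge_neq //=; apply/negP => sq.
  case/splitPr: sq pq uq peq => p1 p2 pq uq peq.
  have [_ _ _ _ /(_ (u :: rcons p1 s))] := tree_e.
  rewrite /ucycle /= rcons_path last_rcons esym eus andbT size_rcons.
  have -> : path e u (rcons p1 s) by move: peq; rewrite -cat_rcons cat_path => /andP[].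
  have -> : (u \notin rcons p1 s) && uniq (rcons p1 s).
    by move: uq; rewrite -cat_rcons -cat_cons cat_uniq => /andP[].
  move=> /(_ isT); case: p1 pq {uq peq} => //= /andP[/andP[_]]; by rewrite eqxx.
apply: connect_sub => y z /and3P[eyz ys zs]; apply: connect1; rewrite /remove_edge /= eyz /=.
apply: contraTneq isT => eqs; have : s \in [set y; z] by rewrite eqs !inE eqxx orbT.
by rewrite !inE eq_sym (negPf ys) eq_sym (negPf zs).
Qed.

Lemma connect_avoid_neighbour s u u' : e s u -> e s u' ->
  connect (avoid s) u u' -> u = u'.
Proof.
move=> esu esu' /connectP[p]; case/shortenP=> q pq uq _ lst.
have us : u != s by rewrite eq_sym edge_neq.
have [_ _ _ _ /(_ (s :: u :: q))] := tree_e.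
rewrite /ucycle (cons_uniq s) (avoid_path_notin us pq) uq andbT /= rcons_path.
rewrite -lst esu esym esu' (sub_path_avoid pq) /= => /(_ isT).
by case: q {pq uq} lst.
Qed.

Definition component s t := [set x | connect (avoid t) s x].

Lemma component_disjoint s u u' : e s u -> e s u' -> u != u' ->
  [disjoint component u s & component u' s].
Proof.
move=> eu eu' /eqP neu; rewrite disjoint_subset; apply/subsetP => x.
rewrite !inE => ux; apply/negP; rewrite connect_avoid_sym => u'x.
exact: neu (connect_avoid_neighbour eu eu' (connect_trans ux u'x)).
Qed.

Lemma component_sub s t u : e s t -> e s u -> u != t -> component u s \subset component s t :\ s.
Proof.
move=> est esu ut; have us : u != s by rewrite eq_sym edge_neq.
apply/subsetP => x; rewrite inE => ux; rewrite in_setD1 (connect_avoid_neq us ux) inE /=.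
have su : connect (avoid t) s u.
  by apply: connect1; rewrite /avoid /= esu ut edge_neq.
apply: connect_trans su _; move: ux => /connectP[p pp lst].
apply/connectP; exists p => //; apply: path_avoid (sub_path_avoid pp) _.
apply: contra ut => tp; apply/eqP; apply: (connect_avoid_neighbour esu est).
exact: (path_connect pp tp).
Qed.

Lemma componentE s t x : e s t -> x \in component s t ->
  x = s \/ exists2 u, (e s u) && (u != t) & x \in component u s.
Proof.
move=> est; rewrite inE => /connectP[p]; case/shortenP=> q pq uq _ ->.
case: q pq uq => [|u q] /=; first by left.
case/andP=> /and3P[esu _ ut] pq /andP[squ uq]; right; exists u; first by rewrite esu.
by rewrite inE; apply/connectP; exists q => //; apply: path_avoid (sub_path_avoid pq) _.
Qed.

Lemma componentC s t : e s t -> component t s = ~: component s t.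
Proof.
move=> est; have ets : e t s by rewrite esym.
apply/setP => x; rewrite !inE; apply/idP/idP => [tx|].
  apply/negP => sx; have : connect (remove_edge e s t) s t.
    apply: connect_trans (_ : connect _ s x) _; first by rewrite connect_remove_edge.
    have rsym : connect_sym (remove_edge e s t).
      by apply: sym_connect_sym => y z; rewrite /remove_edge /= esym setUC.
    rewrite rsym; move: tx; rewrite -connect_remove_edge //.
    by rewrite (@eq_connect _ _ (remove_edge e s t)) // => y z;
      rewrite /remove_edge /= (setUC [set t]).
  rewrite connect_remove_edge // => /(connect_avoid_neq (edge_neq est)).
  by rewrite eqxx.
have [_ _ _ econn _] := tree_e; have /connectP[p] := econn s x.
case/shortenP=> q pq uq _ xq nsx.
have tq : t \in q.
  have : t \in s :: q.
    apply: contraNT nsx => tq; apply/connectP; exists q => //; exact: path_avoid.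
  by rewrite inE eq_sym (negPf (edge_neq est)).
case/splitPr: tq pq uq xq => p1 p2; rewrite cat_path last_cat /= => /and3P[_ _ pt].
rewrite mem_cat cat_uniq inE !negb_or => /andP[/and3P[_ st sp2] _] xq.
apply/connectP; exists p2 => //; apply: path_avoid => //.
by rewrite inE negb_or st.
Qed.

End TreeComponents.

Section DecompositionToTree.
Variables (V : finType) (D : rank_decomposition V).
Variables (lam : {set V} -> nat) (k : nat).
Hypothesis lam_le : forall s t : node D, edge s t -> lam (edge_side s t) <= k.

Local Notation e := (@edge V D).
Let treeD : is_tree e := edge_tree D.

Lemma edge_sideE s t : e s t -> edge_side s t = [set v | leaf D v \in component e s t].
Proof. by move=> est; apply/setP => v; rewrite !inE (connect_remove_edge treeD). Qed.

Lemma edge_side_dtree (s t : node D) : e s t -> exists tr,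
  [/\ dvalid tr, dset tr = edge_side s t & all (fun X => lam X <= k) (dsets tr)].
Proof.
have [_ symE _ _ _] := treeD.
have [n] := ubnP #|component e s t|; elim: n s t => // n IH s t; rewrite ltnS => cn est.
pose Ns := [set u | e s u] :\ t.
have degs : degree e s = #|Ns|.+1.
  by rewrite /degree (cardsD1 t) inE est add1n.
have Ns2 : #|Ns| <= 2 by rewrite -ltnS -degs edge_subcubic.
have NsP u : u \in Ns -> [/\ e s u, e u s, u != t & #|component e u s| < n].
  rewrite !inE => /andP[ut esu]; split=> //; first by rewrite symE.
  apply: leq_trans cn; rewrite (cardsD1 s (component e s t)) inE connect0 add1n ltnS.
  exact: subset_leq_card (component_sub treeD est esu ut).
have leafs v : leaf D v = s -> #|Ns| = 0.
  move=> vs; have := leaf_onto s; rewrite -vs codom_f vs degs eqSS => /esym/eqP //.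
have sideE : 0 < #|Ns| -> edge_side s t = \bigcup_(u in Ns) edge_side u s.
  move=> Ns0; apply/setP => v; rewrite (edge_sideE est) inE; apply/idP/bigcupP.
    case/(componentE est) => [/leafs Ns00|[u]]; first by rewrite Ns00 in Ns0.
    move=> /andP[esu ut] vu; exists u; first by rewrite !inE ut.
    by rewrite (@edge_sideE u s) 1?symE // in_set.
  case=> u /NsP[esu eus ut _]; rewrite (edge_sideE eus) inE.
  by move/(subsetP (component_sub treeD est esu ut)); rewrite in_setD1 => /andP[].
move: Ns2; rewrite leq_eqVlt => /orP[/cards2P[u [u' [neu eqN]]]|].
  have [] := NsP u; first by rewrite eqN !inE eqxx.
  move=> esu eus _ /IH/(_ eus)[tu [vu du wu]].
  have [] := NsP u'; first by rewrite eqN !inE eqxx orbT.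
  move=> esu' eus' _ /IH/(_ eus')[tu' [vu' du' wu']].
  have eqs : dset (DNode tu tu') = edge_side s t.
    rewrite sideE ?eqN ?cards2 ?neu //= du du'.
    by rewrite big_setU1 ?inE // big_set1.
  exists (DNode tu tu'); split=> //.
    rewrite /= vu vu' du du' !edge_sideE //=.
    rewrite disjoint_subset; apply/subsetP => v; rewrite !inE => vu1.
    have := disjointFr (component_disjoint treeD esu esu' neu) (x := leaf D v).
    by rewrite !inE => ->.
  by rewrite /= all_cat wu wu' -[dset tu :|: _]/(dset (DNode tu tu')) eqs lam_le.
(* A node of degree two displays the same set on both of its edges and is suppressed. *)
rewrite ltnS leq_eqVlt => /orP[/cards1P[u eqN]|].
  have [] := NsP u; first by rewrite eqN !inE eqxx.
  move=> esu eus _ /IH/(_ eus)[tu [vu du wu]].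
  by exists tu; split=> //; rewrite sideE ?eqN ?cards1 // big_set1.
rewrite ltnS leqn0 => /eqP N0.
have : s \in codom (leaf D) by rewrite leaf_onto degs N0.
case/codomP=> v sv.
have eqs : edge_side s t = [set v].
  apply/setP => w; rewrite (edge_sideE est) !inE;
  apply/idP/eqP => [|->]; last by rewrite -sv connect0.
  move=> sw; have := @componentE _ _ s t (leaf D w) est; rewrite inE => /(_ sw)[|[u]].
    by rewrite sv => /leaf_inj.
  move=> /andP[esu ut] _; suff : u \in Ns by rewrite (cards0_eq N0) inE.
  by rewrite !inE ut.
exists (DLeaf [set v]); rewrite /= cards1; split=> //.
by rewrite -eqs lam_le.
Qed.

Lemma decomposition_dtree : 1 < #|V| -> lam setT <= k -> exists tr,
  [/\ dvalid tr, dset tr = setT & all (fun X => lam X <= k) (dsets tr)].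
Proof.
have [_ symE _ _ _] := treeD.
(* The root subdivides the only edge at the leaf of [v0]. *)
move=> /ltnW/card_gt0P[v0 _] lamT; set t0 := leaf D v0.
have /cards1P[s eqN] : #|[set s | e t0 s]| == 1.
  by have := leaf_onto t0; rewrite codom_f => /esym.
have ets : e t0 s by have : s \in [set s] := set11 s; rewrite -eqN inE.
have est : e s t0 by rewrite symE.
have [tr [vtr dtr wtr]] := edge_side_dtree est.
have eq0 : edge_side t0 s = [set v0].
  apply/setP => w; rewrite (edge_sideE ets) !inE; apply/idP/eqP => [|->]; last exact: connect0.
  move=> sw; have := @componentE _ _ t0 s (leaf D w) ets; rewrite inE => /(_ sw)[/leaf_inj//|[u]].
  move=> /andP[etu /eqP us] _; have : u \in [set s | e t0 s] by rewrite inE.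
  by rewrite eqN inE => /eqP.
have eqC : edge_side s t0 = ~: [set v0].
  rewrite -eq0; apply/setP => w; rewrite !edge_sideE //.
  have : (leaf D w \in component e s t0) = (leaf D w \notin component e t0 s).
    by rewrite (componentC treeD ets) in_setC.
  by rewrite !inE.
have lam0 : lam [set v0] <= k by rewrite -eq0 lam_le.
exists (DNode (DLeaf [set v0]) tr); rewrite /= cards1 vtr dtr eqC setUCr lamT wtr /=.
by rewrite lam0 -subsets_disjoint subxx.
Qed.

End DecompositionToTree.

(** * Lagrangian chain groups *)

Local Open Scope ring_scope.

Notation chain F V := {ffun V * bool -> F^o}.

Section Chains.
Variables (F : fieldType) (V : finType).
Implicit Types (f g : chain F V) (L : {vspace chain F V}) (Q : {set V * bool}).
Implicit Types (X Y Z S : {set V}) (c : V -> bool).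

Definition chain_mask Q f : chain F V := [ffun i => if i \in Q then f i else 0].

Lemma chain_mask_is_linear Q : linear (chain_mask Q).
Proof.
move=> a f g; apply/ffunP => i; rewrite !ffunE.
by case: ifP; rewrite // scaler0 addr0.
Qed.

HB.instance Definition _ Q := GRing.isLinear.Build F (chain F V) (chain F V) _
  (chain_mask Q) (chain_mask_is_linear Q).

Definition proj Q : 'End(chain F V) := linfun (chain_mask Q).

Lemma projE Q f i : proj Q f i = if i \in Q then f i else 0.
Proof. by rewrite lfunE ffunE. Qed.

Definition coordsp Q : {vspace chain F V} := limg (proj Q).

Lemma mem_coordsp Q f : reflect (forall i, i \notin Q -> f i = 0) (f \in coordsp Q).
Proof.
apply: (iffP idP) => [/memv_imgP[g _ ->] i /negPf iQ|f0]; first by rewrite projE iQ.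
have <- : proj Q f = f; last by apply: memv_img; apply: memvf.
by apply/ffunP => i; rewrite projE; case: ifPn => // /f0.
Qed.

Lemma proj_id Q f : f \in coordsp Q -> proj Q f = f.
Proof. by move=> /mem_coordsp f0; apply/ffunP => i; rewrite projE; case: ifPn => // /f0. Qed.

Lemma lker_proj Q : lker (proj Q) = coordsp (~: Q).
Proof.
apply/vspaceP => f; rewrite memv_ker; apply/eqP/mem_coordsp => [f0 i|f0].
  by rewrite inE negbK => iQ; have := congr1 (fun g : chain F V => g i) f0; rewrite projE iQ ffunE.
apply/ffunP => i; rewrite projE ffunE; case: ifP => // iQ.
by apply: f0; rewrite inE iQ.
Qed.

(** Unit chains bound the dimensions for [Q] and for [~: Q] from above; by rank-nullity for [proj Q]
    the dimensions add up to the total, so both bounds are attained. *)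
Lemma dim_coordsp Q : \dim (coordsp Q) = #|Q|.
Proof.
have le_dim R : (\dim (coordsp R) <= #|R|)%N.
  pose s : seq (chain F V) := [seq [ffun j => (i == j)%:R] | i <- enum R].
  have : (coordsp R <= <<s>>)%VS.
    apply/subvP => f /mem_coordsp f0.
    have -> : f = \sum_(i in R) f i *: [ffun j => (i == j)%:R : F^o].
      apply/ffunP => j; rewrite sum_ffunE.
      case: (boolP (j \in R)) => jR; last first.
        rewrite f0 // big1 // => i iR; rewrite !ffunE.
        by case: eqP => [ij|]; [rewrite -ij iR in jR | rewrite scaler0].
      rewrite (bigD1 j) //= !ffunE eqxx big1 ?addr0 => [|i /andP[_ /negPf ij]].
        by rewrite /GRing.scale /= mulr1.
      by rewrite !ffunE ij scaler0.
    apply: memv_suml => i iR; apply/memvZ/memv_span/map_f.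
    by rewrite mem_enum.
  move/dimvS/leq_trans; apply; apply: leq_trans (dim_span _) _.
  by rewrite size_map cardE.
have := limg_ker_dim (proj Q) fullv; rewrite capfv lker_proj -/(coordsp Q).
have -> : \dim {: chain F V} = #|{: V * bool}| by rewrite dimvf /dim /= muln1.
have arith (a b x y n : nat) :
    (a <= x -> b <= y -> x + y = n -> b + a = n -> a = x)%N.
  by lia.
exact: arith (le_dim Q) (le_dim (~: Q)) (cardsC Q).
Qed.

Definition coords X : {set V * bool} := [set i | i.1 \in X].
Definition supp X := coordsp (coords X).
Definition restr X := proj (coords X).

Lemma mem_supp X f : reflect (forall v b, v \notin X -> f (v, b) = 0) (f \in supp X).
Proof.
apply: (iffP (mem_coordsp _ _)) => [f0 v b vX|f0 [v b]]; first by apply: f0; rewrite inE.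
by rewrite inE; apply: f0.
Qed.

Lemma restrE X f v b : restr X f (v, b) = if v \in X then f (v, b) else 0.
Proof. by rewrite projE inE. Qed.

Lemma restr_supp X f : restr X f \in supp X.
Proof. by apply/mem_supp => v b /negPf vX; rewrite restrE vX. Qed.

Lemma restr_id X f : f \in supp X -> restr X f = f.
Proof. exact: proj_id. Qed.

Lemma restr_restr X Y f : X \subset Y -> restr X (restr Y f) = restr X f.
Proof.
move=> XY; apply/ffunP => -[v b]; rewrite !restrE.
by case: ifP => // /(subsetP XY) ->.
Qed.

Lemma dim_supp X : \dim (supp X) = (#|X| * 2)%N.
Proof.
rewrite dim_coordsp (_ : coords X = setX X setT) ?cardsX ?cardsT ?card_bool //.
by apply/setP => i; rewrite !inE andbT.
Qed.

Lemma lker_restr X : lker (restr X) = supp (~: X).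
Proof. by rewrite lker_proj; congr coordsp; apply/setP => i; rewrite !inE. Qed.

Lemma supp_sub X Y : X \subset Y -> (supp X <= supp Y)%VS.
Proof.
move=> XY; apply/subvP => f /mem_supp f0; apply/mem_supp => v b vY.
by apply: f0; apply: contra vY; apply: (subsetP XY).
Qed.

Lemma supp_cap X Y : (supp X :&: supp Y)%VS = supp (X :&: Y).
Proof.
apply/vspaceP => f; rewrite memv_cap; apply/andP/mem_supp => [[/mem_supp fX /mem_supp fY] v b|f0].
  by rewrite inE negb_and => /orP[/fX|/fY].
by split; apply/mem_supp => v b vX; apply: f0; rewrite inE (negPf vX) ?andbF.
Qed.

Definition zero_on S c := coordsp [set i | (i.1 \in S) ==> (i.2 != c i.1)].

Lemma mem_zero_on S c f :
  reflect (forall v, v \in S -> f (v, c v) = 0) (f \in zero_on S c).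
Proof.
apply: (iffP (mem_coordsp _ _)) => [f0 v vS|f0 [v b]].
  by apply: f0; rewrite inE /= vS eqxx.
by rewrite inE /= negb_imply negbK => /andP[vS /eqP->]; apply: f0.
Qed.

Lemma dim_zero_on S c : (\dim (zero_on S c) + #|S| = #|V| * 2)%N.
Proof.
rewrite dim_coordsp; set Q := [set _ | _].
have <- : #|~: Q| = #|S|.
  rewrite -(card_imset (mem S) (_ : injective (fun v => (v, c v)))); last by move=> x y [].
  apply: eq_card => -[v b]; rewrite !inE negb_imply negbK; apply/andP/imsetP => /=.
    by move=> [vS /eqP->]; exists v.
  by move=> [w wS [-> ->]].
by rewrite cardsC card_prod card_bool.
Qed.

Definition form (e : F) f g : F :=
  \sum_v (f (v, false) * g (v, true) + e * (f (v, true) * g (v, false))).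

Lemma orth_dim e (A B : {vspace chain F V}) : e != 0 ->
    (forall f g, f \in A -> g \in B -> form e f g = 0) ->
  (\dim A + \dim B <= #|V| * 2)%N.
Proof.
move=> e0 orth.
have vbf (C : {vspace chain F V}) (u : 'rV[F]_(\dim C)) :
    \sum_i u 0 i *: (vbasis C)`_i = 0 -> u = 0.
  move=> u0; apply/rowP => i; rewrite mxE.
  have /freeP fr := basis_free (vbasisP C).
  exact: (fr (fun i => u 0 i) u0 i).
have suml (C : {vspace chain F V}) (u : 'rV[F]_(\dim C)) i :
    (\sum_j u 0 j *: (vbasis C)`_j) i = \sum_j u 0 j * (vbasis C)`_j i.
  by rewrite sum_ffunE; apply: eq_bigr => j _; rewrite ffunE.
pose MA : 'M[F]_(\dim A, #|{: V * bool}|) := \matrix_(i, k) (vbasis A)`_i (enum_val k).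
(* [J] turns the form into the standard pairing, and is injective because [e] is nonzero. *)
pose J g (i : V * bool) : F := if i.2 then e * g (i.1, false) else g (i.1, true).
pose MB : 'M[F]_(\dim B, #|{: V * bool}|) := \matrix_(i, k) J (vbasis B)`_i (enum_val k).
have formJ f g : form e f g = \sum_i f i * J g i.
  transitivity (\sum_v \sum_b f (v, b) * J g (v, b)).
    by apply: eq_bigr => v _; rewrite big_bool /J /=; ring.
  by rewrite pair_bigA; apply: eq_bigr => -[].
have rA : \rank MA = \dim A.
  apply/eqP; apply: inj_row_free => u u0; apply: vbf; apply/ffunP => i; rewrite suml ffunE.
  have := congr1 (fun M : 'rV_ _ => M 0 (enum_rank i)) u0; rewrite !mxE => {2}<-.
  by apply: eq_bigr => j _; rewrite mxE enum_rankK.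
have rB : \rank MB = \dim B.
  apply/eqP; apply: inj_row_free => u u0; apply: vbf.
  have Ju i : \sum_j u 0 j * J (vbasis B)`_j i = 0.
    have := congr1 (fun M : 'rV_ _ => M 0 (enum_rank i)) u0; rewrite !mxE => {2}<-.
    by apply: eq_bigr => j _; rewrite mxE enum_rankK.
  apply/ffunP => -[v []]; rewrite suml ffunE; first by rewrite -[RHS](Ju (v, false)).
  apply: (mulfI e0); rewrite mulr0 -[RHS](Ju (v, true)) mulr_sumr.
  by apply: eq_bigr => j _; rewrite /J /= mulrCA.
have M0 : MA *m MB^T = 0.
  apply/matrixP => i j; rewrite !mxE.
  rewrite -[RHS](orth _ _ (vbasis_mem (mem_nth 0 (_ : i < _)%N))
                          (vbasis_mem (mem_nth 0 (_ : j < _)%N))); last 2 first.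
  - by rewrite size_tuple.
  - by rewrite size_tuple.
  rewrite formJ [RHS](reindex_onto (@enum_val _ _) (@enum_rank _)) /= => [|k _];
    last exact: enum_rankK.
  by apply: eq_big => [k|k _]; rewrite ?enum_valK ?eqxx // !mxE.
have := mulmx0_rank_max M0; rewrite mxrank_tr rA rB.
by rewrite card_prod card_bool.
Qed.

Lemma orth_dim_supp e X (A B : {vspace chain F V}) : e != 0 ->
    (A <= supp X)%VS -> (B <= supp X)%VS ->
    (forall f g, f \in A -> g \in B -> form e f g = 0) ->
  (\dim A + \dim B <= #|X| * 2)%N.
Proof.
move=> e0 AX BX orth.
have : (\dim (A + supp (~: X)) + \dim B <= #|V| * 2)%N.
  apply: orth_dim e0 _ => f g /memv_addP[f1 f1A [f2 /mem_supp f2X ->]] gB.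
  rewrite -[RHS](orth f1 g) //; apply: eq_bigr => v _; rewrite !ffunE.
  case: (boolP (v \in X)) => vX; first by rewrite !f2X ?inE ?vX // !addr0.
  by have /mem_supp gX := subvP BX _ gB; rewrite !gX // !mulr0.
rewrite dimv_disjoint_sum; last first.
  apply/eqP; rewrite -subv0; apply: subv_trans (capvS AX (subvv _)) _.
  rewrite supp_cap setICr; apply/subvP => f /mem_supp f0; rewrite memv0; apply/eqP/ffunP => -[v b].
  by rewrite ffunE f0 // inE.
by rewrite dim_supp; have := cardsC X; lia.
Qed.

Lemma form_restr e X f g : g \in supp X -> form e (restr X f) g = form e f g.
Proof.
move=> /mem_supp gX; apply: eq_bigr => v _; rewrite !restrE.
by case: ifPn => // /gX g0; rewrite !g0 !mulr0.
Qed.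

Definition isotropic e L := forall f g, f \in L -> g \in L -> form e f g = 0.

(** The existential [e] treats symmetric matrices, with [e = -1], and skew-symmetric ones, with
    [e = 1], together. By [orth_dim] no isotropic space is larger. *)
Definition lagrangian L := \dim L = #|V| /\ exists2 e, e != 0 & isotropic e L.

Lemma dim_restr L X : (\dim (L :&: supp (~: X)) + \dim (restr X @: L) = \dim L)%N.
Proof. by rewrite -lker_restr limg_ker_dim. Qed.

Lemma isotropic_restr_dim e L X : e != 0 -> isotropic e L ->
  (\dim (restr X @: L) + \dim (L :&: supp X) <= #|X| * 2)%N.
Proof.
move=> e0 iso; apply: orth_dim_supp e0 _ (capvSr _ _) _.
  by apply/subvP => _ /memv_imgP[f _ ->]; apply: restr_supp.
move=> _ g /memv_imgP[f fL ->]; rewrite memv_cap => /andP[gL gX].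
by rewrite form_restr // iso.
Qed.

Definition conn L X := (#|X| - \dim (L :&: supp X))%N.

Lemma lagrangian_dim_le L X : lagrangian L -> (\dim (L :&: supp X) <= #|X|)%N.
Proof.
move=> [_ [e e0 iso]]; have := isotropic_restr_dim X e0 iso.
suff : (\dim (L :&: supp X) <= \dim (restr X @: L))%N by lia.
apply: dimvS; apply/subvP => f; rewrite memv_cap => /andP[fL fX].
by rewrite -(restr_id fX) memv_img.
Qed.

(** The orthogonality bounds for [X] and for [~: X] become opposite inequalities after
    rank-nullity. *)
Lemma lagrangian_dim_compl L X : lagrangian L ->
  (\dim (L :&: supp (~: X)) + #|X| = \dim (L :&: supp X) + #|~: X|)%N.
Proof.
move=> [dL [e e0 iso]]; have := isotropic_restr_dim X e0 iso.
have := isotropic_restr_dim (~: X) e0 iso.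
have := dim_restr L X; have := dim_restr L (~: X); rewrite setCK dL.
by have := cardsC X; lia.
Qed.

Lemma conn_dim L X : lagrangian L -> (conn L X + \dim (L :&: supp X) = #|X|)%N.
Proof. by move=> /(@lagrangian_dim_le _ X); rewrite /conn; lia. Qed.

Lemma connC L X : lagrangian L -> conn L (~: X) = conn L X.
Proof.
move=> lagL; have := lagrangian_dim_compl X lagL.
by have := conn_dim X lagL; have := conn_dim (~: X) lagL; lia.
Qed.

Lemma conn0 L : conn L set0 = 0%N.
Proof. by rewrite /conn cards0. Qed.

Lemma conn_submod L X Y : lagrangian L ->
  (conn L (X :&: Y) + conn L (X :|: Y) <= conn L X + conn L Y)%N.
Proof.
move=> lagL; have := cardsUI X Y.
have := conn_dim X lagL; have := conn_dim Y lagL.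
have := conn_dim (X :&: Y) lagL; have := conn_dim (X :|: Y) lagL.
have := dimv_sum_cap (L :&: supp X) (L :&: supp Y).
have -> : (L :&: supp X :&: (L :&: supp Y) = L :&: supp (X :&: Y))%VS.
  by apply/vspaceP => f; rewrite -supp_cap !memv_cap andbACA andbb.
have /dimvS : (L :&: supp X + L :&: supp Y <= L :&: supp (X :|: Y))%VS.
  by rewrite subv_add !capvS ?supp_sub ?subsetUl ?subsetUr.
lia.
Qed.

(** The two choices at an element of [S] amount to deleting it with or without a twist there
    beforehand. *)
Definition minor_chain L S c := (restr (~: S) @: (L :&: zero_on S c))%VS.

(* A choice of coordinates on [S] keeps the connectivity of [Y]: if both choices
   at [v] dropped below [r], with witnesses [Z1] and [Z2], then [Z1 :&: Z2] and
   [v |: (Z1 :|: Z2)] would contradict [min_r]. *)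
Lemma linking L Y S r : [disjoint Y & S] ->
    (forall Z, Y \subset Z -> Z \subset Y :|: S -> \dim (L :&: supp Z) + r <= #|Z|)%N ->
  exists c, (\dim (minor_chain L S c :&: supp Y) + r <= #|Y|)%N.
Proof.
have [n] := ubnP #|S|; elim: n S L => // n IH S L; rewrite ltnS => cn dis min_r.
have [S0|[v vS]] := set_0Vmem S.
  exists (fun=> false); apply: leq_trans (min_r Y (subxx _) (subsetUl _ _)).
  rewrite leq_add2r; apply: dimvS; apply: capvS (subvv _).
  apply/subvP => _ /memv_imgP[f + ->]; rewrite memv_cap => /andP[fL _].
  by rewrite restr_id // S0; apply/mem_supp => w b; rewrite !inE.
pose S1 := S :\ v; pose L1 b := minor_chain L [set v] (fun=> b).
have dis1 : [disjoint Y & S1] by apply: disjointWr dis; apply: subD1set.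
have vY : v \notin Y by rewrite (disjointFl dis vS).
have cn1 : (#|S1| < n)%N by apply: leq_trans cn; rewrite (cardsD1 v S) vS.
suff [b min1] : exists b, forall Z, Y \subset Z -> Z \subset Y :|: S1 ->
    (\dim (L1 b :&: supp Z) + r <= #|Z|)%N.
  have [c1 c1P] := IH S1 (L1 b) cn1 dis1 min1.
  exists (fun w => if w == v then b else c1 w).
  apply: leq_trans c1P; rewrite leq_add2r; apply/dimvS/capvS => //.
  apply/subvP => _ /memv_imgP[f + ->]; rewrite memv_cap => /andP[fL /mem_zero_on f0].
  have -> : restr (~: S) f = restr (~: S1) (restr (~: [set v]) f).
    apply/ffunP => -[w b']; rewrite !restrE !inE.
    by case: eqVneq => [->|]; rewrite ?vS.
  apply: memv_img; rewrite memv_cap memv_img /=; last first.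
    rewrite memv_cap fL; apply/mem_zero_on => w; rewrite inE => /eqP->.
    by have := f0 v vS; rewrite eqxx.
  apply/mem_zero_on => w; rewrite restrE !inE => /andP[wv wS]; rewrite wv.
  by have := f0 w wS; rewrite (negPf wv).
apply: contrapT => noB.
have {noB} noB b : exists Z, [/\ Y \subset Z, Z \subset Y :|: S1 &
    (#|Z| < \dim (L1 b :&: supp Z) + r)%N].
  apply: contrapT => noZ; apply: noB; exists b => Z YZ ZS; rewrite leqNgt.
  by apply/negP => ltZ; apply: noZ; exists Z.
have [Z1 [YZ1 ZS1 lt1]] := noB false; have [Z2 [YZ2 ZS2 lt2]] := noB true.
have vYS1 : v \notin Y :|: S1 by rewrite !inE eqxx (negPf vY).
have vZ1 : v \notin Z1 by apply: contra vYS1; apply: (subsetP ZS1).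
have vZ2 : v \notin Z2 by apply: contra vYS1; apply: (subsetP ZS2).
pose H b Z := (L :&: supp (v |: Z) :&: zero_on [set v] (fun=> b))%VS.
have L1H b Z : (\dim (L1 b :&: supp Z) <= \dim (H b Z))%N.
  apply: leq_trans (_ : \dim (restr (~: [set v]) @: H b Z) <= _)%N; last first.
    by rewrite -(limg_ker_dim (restr (~: [set v])) (H b Z)) leq_addl.
  apply: dimvS; apply/subvP => _ /memv_capP[/memv_imgP[f + ->] /mem_supp fZ].
  rewrite memv_cap => /andP[fL f0]; apply: memv_img; rewrite /H !memv_cap fL f0 andbT /=.
  apply/mem_supp => w b'; rewrite !inE negb_or => /andP[wv wZ].
  by have := fZ w b' wZ; rewrite restrE !inE wv.
(* A common member vanishes at both coordinates of [v], hence is supported on [Z1 :&: Z2]. In the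
   final count the two strict bounds gain 2, while [v] costs only 1. *)
have dimH : (\dim (H false Z1) + \dim (H true Z2) <=
    \dim (L :&: supp (v |: (Z1 :|: Z2))) + \dim (L :&: supp (Z1 :&: Z2)))%N.
  rewrite -dimv_sum_cap leq_add //; apply: dimvS.
    rewrite subv_add; apply/andP; split; apply: subv_trans (capvSl _ _) _; apply: capvS => //;
      by apply/supp_sub/setUS; rewrite ?subsetUl ?subsetUr.
  apply/subvP => f /memv_capP[]; rewrite !memv_cap.
  move=> /andP[/andP[-> /mem_supp fZ1] /mem_zero_on f0].
  move=> /andP[/andP[_ /mem_supp fZ2] /mem_zero_on f1] /=.
  apply/mem_supp => w b; rewrite inE negb_and.
  have [-> _|wv wZ] := eqVneq w v.
    by case: b; [apply: f1 | apply: f0]; rewrite inE.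
  by case/orP: wZ => wZ; [apply: fZ1 | apply: fZ2]; rewrite !inE negb_or wv.
have := L1H false Z1; have := L1H true Z2.
have YSS : Y :|: S1 \subset Y :|: S by apply/setUS/subD1set.
have : (\dim (L :&: supp (Z1 :&: Z2)) + r <= #|Z1 :&: Z2|)%N.
  apply: min_r; first by rewrite subsetI YZ1.
  by apply: subset_trans (subsetIl _ _) (subset_trans ZS1 YSS).
have : (\dim (L :&: supp (v |: (Z1 :|: Z2))) + r <= #|v |: (Z1 :|: Z2)|)%N.
  apply: min_r; first exact: subset_trans YZ1 (subset_trans (subsetUl _ _) (subsetUr _ _)).
  rewrite !subUset sub1set !inE vS orbT /=.
  by rewrite (subset_trans ZS1 YSS) (subset_trans ZS2 YSS).
rewrite cardsU1 inE negb_or vZ1 vZ2 /=; have := cardsUI Z1 Z2.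
move: lt1 lt2 dimH; clear; lia.
Qed.

End Chains.

(** * Embeddings of parts *)

Section MinorOfLagrangian.
Variables (F : fieldType) (V : finType).
Implicit Types (f g : chain F V) (L : {vspace chain F V}).
Implicit Types (X Y Z S : {set V}) (c : V -> bool).

Lemma formDl (e : F) f1 f2 g : form e (f1 + f2) g = form e f1 g + form e f2 g.
Proof. by rewrite -big_split; apply: eq_bigr => v _; rewrite !ffunE /=; ring. Qed.

Lemma zero_on_term (e : F) S c f g v : f \in zero_on F S c -> g \in zero_on F S c ->
  v \in S -> f (v, false) * g (v, true) + e * (f (v, true) * g (v, false)) = 0.
Proof.
move=> /mem_zero_on f0 /mem_zero_on g0 vS; have := f0 v vS; have := g0 v vS.
by case: (c v) => -> ->; rewrite ?mulr0 ?mul0r ?mulr0 addr0.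
Qed.

Lemma minor_chain_supp L S c : (minor_chain L S c <= supp F (~: S))%VS.
Proof. by apply/subvP => _ /memv_imgP[f _ ->]; apply: restr_supp. Qed.

Lemma minor_chain_isotropic e L S c : isotropic e L -> isotropic e (minor_chain L S c).
Proof.
move=> iso _ _ /memv_imgP[f + ->] /memv_imgP[g + ->].
rewrite !memv_cap => /andP[fL f0] /andP[gL g0]; rewrite -[RHS](iso f g) //.
apply: eq_bigr => v _; rewrite !restrE inE; case: (boolP (v \in S)) => //= vS.
by rewrite (zero_on_term _ f0 g0 vS) !mulr0 addr0.
Qed.

(** The chains [W] killed by the restriction are orthogonal to [L + zero_on F S c]: a large kernel
    makes this sum small, and the intersection [L :&: zero_on F S c] correspondingly large. *)
Lemma minor_chain_dim L S c : lagrangian L -> (#|V| <= \dim (minor_chain L S c) + #|S|)%N.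
Proof.
move=> [dL [e e0 iso]]; pose W := (L :&: zero_on F S c :&: supp F S)%VS.
have : (\dim (L + zero_on F S c) + \dim W <= #|V| * 2)%N.
  apply: orth_dim e0 _ => _ g /memv_addP[f1 f1L [f2 f20 ->]].
  rewrite !memv_cap => /andP[/andP[gL g0] /mem_supp gS].
  rewrite formDl iso // add0r; apply: big1 => v _.
  case: (boolP (v \in S)) => vS; first exact: zero_on_term f20 g0 vS.
  by rewrite !gS // !mulr0 addr0.
have := dimv_sum_cap L (zero_on F S c); have := dim_zero_on F S c.
have := dim_restr (L :&: zero_on F S c) (~: S).
by rewrite setCK -/W -/(minor_chain L S c) dL; lia.
Qed.

Lemma sub_minor_chain L S c X : X \subset ~: S ->
  (L :&: supp F X <= minor_chain L S c :&: supp F X)%VS.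
Proof.
move=> XS; apply/subvP => f /memv_capP[fL fX]; rewrite memv_cap fX andbT.
rewrite -(restr_id (subvP (supp_sub F XS) _ fX)); apply: memv_img.
rewrite memv_cap fL; apply/mem_zero_on => v vS; apply: (mem_supp _ _ fX).
by apply/negP => /(subsetP XS); rewrite inE vS.
Qed.

Lemma restr_minor_chain L S c X : X \subset ~: S ->
  (restr F X @: minor_chain L S c <= restr F X @: L)%VS.
Proof.
move=> XS; apply/subvP => _ /memv_imgP[_ /memv_imgP[f + ->] ->].
by rewrite memv_cap => /andP[fL _]; rewrite restr_restr // memv_img.
Qed.

Lemma linked_minor L X Y : lagrangian L -> Y \subset X -> conn L X = conn L Y ->
    (forall Z, Y \subset Z -> Z \subset X -> conn L Y <= conn L Z)%N ->
  exists c, let L' := minor_chain L (X :\: Y) c in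
    [/\ (restr F Y @: L' = restr F Y @: L)%VS,
        (restr F (~: X) @: L' = restr F (~: X) @: L)%VS,
        (L' :&: supp F Y = L :&: supp F Y)%VS &
        (L' :&: supp F (~: X) = L :&: supp F (~: X))%VS].
Proof.
move=> lagL YX eqr min_r; set S := X :\: Y; set r := conn L Y in eqr min_r.
have YS : Y :|: S = X by rewrite -{1}(setIidPr YX) setID.
have dis : [disjoint Y & S] by rewrite disjoint_sym disjoints_subset subsetDr.
have [|c le_c] := @linking F V L Y S r dis.
  move=> Z YZ; rewrite YS => ZX; have := min_r Z YZ ZX.
  by have := conn_dim Z lagL; lia.
exists c => L'; have [dL [e e0 iso]] := lagL.
have YS' : Y \subset ~: S by rewrite -disjoints_subset.
have BS' : ~: X \subset ~: S by rewrite setCS subsetDl.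
have dimL' : (#|Y| + #|~: X| <= \dim L')%N.
  have := minor_chain_dim S c lagL; rewrite -/L'.
  have := cardsC X; have : (#|X| = #|Y| + #|S|)%N.
    by rewrite -YS cardsU (disjoint_setI0 dis) cards0 subn0.
  lia.
have isoB := isotropic_restr_dim (~: X) e0 (minor_chain_isotropic (S := S) (c := c) iso).
have capY : (L' :&: supp F X = L' :&: supp F Y)%VS.
  apply/vspaceP => f; rewrite !memv_cap; case: (boolP (f \in L')) => //= fL'.
  have /mem_supp fS := subvP (minor_chain_supp _ _ _) _ fL'.
  apply/idP/idP => /mem_supp fX; apply/mem_supp => v b vX; last first.
    by apply: fX; apply: contra vX; apply: (subsetP YX).
  case: (boolP (v \in X)) => vX'; last exact: fX.
  by apply: fS; rewrite !inE vX vX'.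
have capB : (L' :&: supp F (~: Y) = L' :&: supp F (~: X))%VS.
  apply/vspaceP => f; rewrite !memv_cap; case: (boolP (f \in L')) => //= fL'.
  have /mem_supp fS := subvP (minor_chain_supp _ _ _) _ fL'.
  apply/idP/idP => /mem_supp fX; apply/mem_supp => v b; rewrite inE negbK => vX; last first.
    by apply: fX; rewrite inE negbK; apply: (subsetP YX).
  case: (boolP (v \in Y)) => vY; first by apply: fX; rewrite inE vY.
  by apply: fS; rewrite !inE vX vY.
have dY := dim_restr L' Y; have dB := dim_restr L' (~: X).
rewrite setCK capY in dB; rewrite capB in dY.
have lY := dim_restr L Y; have lB := dim_restr L (~: X); rewrite setCK in lB.
have cX := conn_dim X lagL; have cY := conn_dim Y lagL.
have cCX := conn_dim (~: X) lagL; have cCY := conn_dim (~: Y) lagL.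
rewrite !connC // eqr -/r in cX cY cCX cCY.
have nX := cardsC X; have nY := cardsC Y.
rewrite -/L' in le_c isoB.
(* One inclusion of each equality is clear, so dimensions decide. [linking] bounds [L'] on [Y] from
   above, hence its restriction to [~: X] from below; isotropy then bounds [L'] on [~: X] from
   above, hence its restriction to [Y] from below. *)
have bounds : [/\ (\dim (restr F Y @: L) <= \dim (restr F Y @: L'))%N,
    (\dim (restr F (~: X) @: L) <= \dim (restr F (~: X) @: L'))%N,
    (\dim (L' :&: supp F Y) <= \dim (L :&: supp F Y))%N &
    (\dim (L' :&: supp F (~: X)) <= \dim (L :&: supp F (~: X)))%N].
  move: le_c isoB dimL' dY dB lY lB cX cY cCX cCY nX nY; rewrite dL.
  move: (\dim (L' :&: supp F Y)) (\dim (restr F (~: X) @: L')) (\dim L').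
  move: (\dim (L' :&: supp F (~: X))) (\dim (restr F Y @: L')) (\dim (restr F Y @: L)).
  move: (\dim (restr F (~: X) @: L)) (\dim (L :&: supp F X)) (\dim (L :&: supp F Y)).
  move: (\dim (L :&: supp F (~: X))) (\dim (L :&: supp F (~: Y))).
  by clear; split; lia.
case: bounds => b1 b2 b3 b4; split; apply/eqP.
- by rewrite eqEdim restr_minor_chain.
- by rewrite eqEdim restr_minor_chain.
- by rewrite eq_sym eqEdim sub_minor_chain.
- by rewrite eq_sym eqEdim sub_minor_chain.
Qed.

End MinorOfLagrangian.

Record piece (F : fieldType) := Piece
  { pV : finType; pL : {vspace chain F pV}; pX : {set pV} }.

Section Embeddings.
Variable F : fieldType.
Implicit Types p q r : piece F.

Definition live p (f : chain F (pV p)) := f \in (restr F (pX p) @: pL p)%VS.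

Definition emb p q := ((pV p -> pV q) * (pV q -> bool))%type.

(** A relation and not a map: [g] determines [f], but the coordinate not chosen at a removed element
    is free. *)
Definition ext p q (d : emb p q) (f : chain F (pV p)) (g : chain F (pV q)) :=
  [/\ f \in supp F (pX p), g \in supp F (pX q),
      forall v b, v \in pX p -> g (d.1 v, b) = f (v, b) &
      forall w, w \in pX q -> w \notin d.1 @: pX p -> g (w, d.2 w) = 0].

(* The classes of live chains modulo [pL] are the ways in which a piece meets
   its complement; [ext d] induces a bijection between these classes. *)
Record embeds p q (d : emb p q) : Prop := Embeds {
  emb_inj : {in pX p &, injective d.1};
  emb_sub : d.1 @: pX p \subset pX q;
  emb_live : forall f, live f -> exists2 g, live g & ext d f g;
  emb_live_inv : forall f g, ext d f g -> live g -> live f;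
  emb_mem : forall f g, ext d f g -> live f -> live g -> (f \in pL p) = (g \in pL q);
  emb_onto : forall h, live h ->
    exists f g, [/\ live f, live g, ext d f g & h - g \in pL q] }.

Definition ple p q := exists d : emb p q, embeds d.

Lemma live_supp p (f : chain F (pV p)) : live f -> f \in supp F (pX p).
Proof. by case/memv_imgP=> g _ ->; apply: restr_supp. Qed.

Lemma liveB p (f g : chain F (pV p)) : live f -> live g -> live (f - g).
Proof. exact: memvB. Qed.

Lemma live_mem p (f : chain F (pV p)) : f \in supp F (pX p) -> f \in pL p -> live f.
Proof. by move=> fX fL; rewrite /live -(restr_id fX) memv_img. Qed.

Lemma extB p q (d : emb p q) f f' g g' : ext d f g -> ext d f' g' -> ext d (f - f') (g - g').
Proof.
move=> [fX gX fg g0] [fX' gX' fg' g0']; split; [exact: memvB | exact: memvB | |].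
  by move=> v b vX; rewrite !ffunE fg ?fg'.
by move=> w wX wp; rewrite !ffunE g0 ?g0' // subr0.
Qed.

Lemma linked_ple (V : finType) (L : {vspace chain F V}) (X Y : {set V}) :
    lagrangian L -> Y \subset X -> conn L X = conn L Y ->
    (forall Z : {set V}, Y \subset Z -> Z \subset X -> conn L Y <= conn L Z)%N ->
  ple (Piece L Y) (Piece L X).
Proof.
move=> lagL YX eqr min_r; have [c] := linked_minor lagL YX eqr min_r.
set L' := minor_chain _ _ _ => -[restrY restrB capY capB].
pose S := X :\: Y.
have SX : S \subset X by apply: subsetDl.
have YS' : Y \subset ~: S by rewrite setCD subsetUr.
have BS' : ~: X \subset ~: S by rewrite setCS.
have memL' k : k \in L -> (forall w, w \in S -> k (w, c w) = 0) -> restr F (~: S) k \in L'.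
  by move=> kL k0; apply: memv_img; rewrite memv_cap kL; apply/mem_zero_on.
have extE f g : ext (p := Piece L Y) (q := Piece L X) (id, c) f g <->
    [/\ g \in supp F X, f = restr F Y g & forall w, w \in S -> g (w, c w) = 0].
  rewrite /ext /= imset_id; split.
    move=> [fY gX fg g0]; split=> //; last by move=> w; rewrite inE => /andP[wY wX]; apply: g0.
    apply/ffunP => -[v b]; rewrite restrE; case: ifPn => vY; first by rewrite fg.
    exact: (mem_supp _ _ fY).
  move=> [gX -> g0]; split=> //; first exact: restr_supp.
    by move=> v b vY; rewrite restrE vY.
  by move=> w wX wY; apply: g0; rewrite inE wY.
have liftS h (Z : {set V}) : Z \subset ~: S -> h \in (restr F Z @: L')%VS -> exists k,
    [/\ k \in L, forall w, w \in S -> k (w, c w) = 0 & h = restr F Z k].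
  move=> ZS /memv_imgP[_ /memv_imgP[k + ->] ->]; rewrite memv_cap => /andP[kL /mem_zero_on k0].
  by exists k; split; rewrite ?restr_restr.
have ext_restr (k : chain F V) : (forall w, w \in S -> k (w, c w) = 0) ->
    ext (p := Piece L Y) (q := Piece L X) (id, c) (restr F Y k) (restr F X k).
  move=> k0; apply/extE; split; [exact: restr_supp | by rewrite restr_restr |].
  by move=> w wS; rewrite restrE (subsetP SX) // k0.
exists (id, c); split=> /=.
- by move=> v w _ _.
- by rewrite imset_id.
- rewrite /live /= -restrY => f fY; have [k [kL k0 ->]] := liftS f Y YS' fY.
  by exists (restr F X k); [apply: memv_img | apply: ext_restr].
- move=> f g /extE[_ -> _] /memv_imgP[m mL ->].
  by rewrite /live /= restr_restr // memv_img.
- move=> f g /extE[gX eqf g0] _ /memv_imgP[m mL] /= eqg.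
  have fY : f \in supp F Y by rewrite eqf restr_supp.
  have m0 w : w \in S -> m (w, c w) = 0.
    by move=> wS; have := g0 w wS; rewrite eqg restrE (subsetP SX).
  apply/idP/idP => [fL|gL].
    (* The part of [m] off [X] is a member of [L'] supported there, hence of [L]; subtracting it
       from [m] leaves [g]. *)
    have /memv_capP[fL' _] : f \in (L' :&: supp F Y)%VS by rewrite capY memv_cap fL.
    have : restr F (~: S) m - f \in (L' :&: supp F (~: X))%VS.
      rewrite memv_cap memvB ?memL' //=; apply/mem_supp => v b; rewrite inE negbK => vX.
      rewrite !ffunE eqf eqg restr_restr // !restrE !inE vX andbT negbK.
      by case: (v \in Y); rewrite /= subrr.
    rewrite capB => /memv_capP[bL _].
    suff -> : g = m - (restr F (~: S) m - f) by apply: memvB.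
    apply/ffunP => -[v b]; rewrite eqf eqg restr_restr // !ffunE !restrE !inE.
    case: (boolP (v \in X)) => vX /=; last first.
      by rewrite andbF /= (contraNF (subsetP YX v) vX) subr0 subrr.
    by rewrite andbT negbK; case: (v \in Y); rewrite /= subrr subr0.
  suff : f \in (L' :&: supp F Y)%VS by rewrite capY => /memv_capP[].
  rewrite memv_cap fY andbT; suff -> : f = restr F (~: S) g by apply: memL'.
  apply/ffunP => -[v b]; rewrite eqf !restrE !inE.
  case: (boolP (v \in Y)) => //= vY; case: (boolP (v \in X)) => //= vX.
  by rewrite (mem_supp _ _ gX).
- move=> _ /memv_imgP[m mL ->] /=.
  (* Off [X], [m] agrees with some [k] in [L] vanishing at the chosen coordinates. Then [m - k] is
     supported on [X], so [restr F X k] represents the class. *)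
  have : restr F (~: X) m \in (restr F (~: X) @: L')%VS by rewrite restrB memv_img.
  case/(liftS _ _ BS') => k [kL k0 eqk].
  exists (restr F Y k), (restr F X k); split;
    [exact: memv_img | exact: memv_img | exact: ext_restr |].
  suff -> : restr F X m - restr F X k = m - k by apply: memvB.
  apply/ffunP => -[v b]; rewrite !ffunE !restrE; case: (boolP (v \in X)) => // vX.
  have := congr1 (fun f : chain F V => f (v, b)) eqk; rewrite /= !restrE inE vX /= => ->.
  by rewrite !subrr.
Qed.

Lemma ext_id p f g :
  ext (p := p) (q := p) (id, fun=> false) f g <-> f \in supp F (pX p) /\ f = g.
Proof.
rewrite /ext /= imset_id; split=> [[fX gX fg _]|[fX <-]]; last first.
  by split=> // w ->.
split=> //; apply/ffunP => -[v b]; case: (boolP (v \in pX p)) => [/fg->//|vX].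
by rewrite (mem_supp _ _ fX) // (mem_supp _ _ gX).
Qed.

Lemma embeds_id p : @embeds p p (id, fun=> false).
Proof.
split=> /=.
- by move=> v w _ _.
- by rewrite imset_id.
- by move=> f fl; exists f => //; apply/ext_id; split=> //; apply: live_supp.
- by move=> f g /ext_id[_ <-].
- by move=> f g /ext_id[_ <-].
- move=> h hl; exists h, h; split=> //; last by rewrite subrr mem0v.
  by apply/ext_id; split=> //; apply: live_supp.
Qed.

(** An element removed by the composite is either the image of one removed in [q], whose choice is
    transported, or is removed by [d']. *)
Definition comp_emb p q r (d : emb p q) (d' : emb q r) : emb p r :=
  (fun v => d'.1 (d.1 v),
   fun w => if [pick v in pX q | d'.1 v == w] is Some v then d.2 v else d'.2 w).

Lemma ext_comp p q r (d : emb p q) (d' : emb q r) f h :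
    embeds d -> embeds d' ->
  ext (comp_emb d d') f h <-> exists2 g, ext d f g & ext d' g h.
Proof.
move=> [inj sub _ _ _ _] [inj' sub' _ _ _ _].
have im_comp : (fun v => d'.1 (d.1 v)) @: pX p = d'.1 @: (d.1 @: pX p).
  by rewrite -imset_comp.
split=> [[fX hX fh h0]|[g [fX gX fg g0] [_ hX gh h0]]].
  pose g : chain F (pV q) := [ffun i => if i.1 \in pX q then h (d'.1 i.1, i.2) else 0].
  have gX : g \in supp F (pX q) by apply/mem_supp => v b /negPf vX; rewrite ffunE /= vX.
  exists g; split=> //.
  - by move=> v b vX; rewrite ffunE /= fh // (subsetP sub) // imset_f.
  - move=> v vX vd; rewrite ffunE /= vX; have := h0 (d'.1 v).
    rewrite (subsetP sub') ?imset_f // /= im_comp => /(_ isT).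
    have -> : d'.1 v \notin d'.1 @: (d.1 @: pX p).
      apply: contra vd => /imsetP[u ud eqv]; suff -> : v = u by [].
      by apply: inj' => //; apply: (subsetP sub).
    move=> /(_ isT); case: pickP => [u /andP[uX /eqP eqv]|/(_ v)]; last by rewrite vX eqxx.
    by rewrite (inj' u v).
  - by move=> v b vX; rewrite ffunE /= vX.
  - move=> w wX wd; have := h0 w wX; rewrite im_comp /=.
    have -> : w \notin d'.1 @: (d.1 @: pX p).
      by apply: contra wd; apply/subsetP/imsetS.
    move=> /(_ isT); case: pickP => [u /andP[uX /eqP eqv]|//].
    by rewrite -eqv imset_f in wd.
split=> // [v b vX|w wX]; first by rewrite gh ?fg // (subsetP sub) // imset_f.
rewrite /= im_comp => wd; case: pickP => [u /andP[uX /eqP eqv]|nou].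
  by rewrite -eqv gh // g0 //; apply: contra wd; rewrite -eqv; apply: imset_f.
by apply: h0 => //; apply/negP => /imsetP[u uX eqw]; have := nou u; rewrite uX eqw eqxx.
Qed.

Lemma embeds_comp p q r (d : emb p q) (d' : emb q r) :
  embeds d -> embeds d' -> embeds (comp_emb d d').
Proof.
move=> ed ed'; have extE := ext_comp _ _ ed ed'.
have [inj sub lv lvi mm ont] := ed; have [inj' sub' lv' lvi' mm' ont'] := ed'.
split=> /=.
- move=> v w vX wX /inj' /inj; rewrite !(subsetP sub) ?imset_f //; exact.
- apply/subsetP => _ /imsetP[v vX ->]; apply: (subsetP sub'); apply: imset_f.
  by apply: (subsetP sub); apply: imset_f.
- move=> f /lv[g /lv'[h hl gh] fg]; exists h => //; apply/extE; by exists g.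
- by move=> f h /extE[g fg gh] /(lvi' _ _ gh); apply: lvi.
- move=> f h /extE[g fg gh] fl hl; have gl := lvi' _ _ gh hl.
  by rewrite (mm _ _ fg) // (mm' _ _ gh).
- move=> h /ont'[g [h1 [gl h1l gh1 hh1]]].
  have [f [g1 [fl g1l fg1 gg1]]] := ont _ gl.
  have [h2 h2l g1h2] := lv' _ g1l.
  exists f, h2; split=> //; first by apply/extE; exists g1.
  have -> : h - h2 = (h - h1) + (h1 - h2) by rewrite addrA subrK.
  apply: memvD => //; rewrite -(mm' _ _ (extB gh1 g1h2)) //; exact: liveB.
Qed.

Lemma ple_trans p q r : ple p q -> ple q r -> ple p r.
Proof. by move=> [d ed] [d' ed']; exists (comp_emb d d'); apply: embeds_comp. Qed.

End Embeddings.

Lemma pigeonhole (T : finType) (s : nat -> T) : exists i j, (i < j)%N /\ s i = s j.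
Proof.
apply: contrapT => no; suff : (#|'I_#|T|.+1| <= #|T|)%N by rewrite card_ord ltnn.
apply: (leq_card (fun i : 'I__ => s i)) => i j eqs; apply/val_inj/eqP; case: ltngtP => // ij.
  by case: no; exists i, j.
by case: no; exists j, i.
Qed.

(** * Gluing embeddings of disjoint parts *)

Section Gluing.
Variable F : fieldType.

Section Glue.
Variables (V V' : finType) (L : {vspace chain F V}) (L' : {vspace chain F V'}).
Variables (Y Z : {set V}) (Y' Z' : {set V'}).
Hypotheses (YZ : [disjoint Y & Z]) (YZ' : [disjoint Y' & Z']).
Variables (d1 : emb (Piece L Y) (Piece L' Y')) (d2 : emb (Piece L Z) (Piece L' Z')).
Hypotheses (e1 : embeds d1) (e2 : embeds d2).
(** The classes on the two parts do not by themselves tell which sums are live on the union or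
    belong to the space, so this is assumed to agree. *)
Hypothesis compat : forall f1 f2 g1 g2,
  live (p := Piece L Y) f1 -> live (p := Piece L Z) f2 ->
  live (p := Piece L' Y') g1 -> live (p := Piece L' Z') g2 ->
  ext d1 f1 g1 -> ext d2 f2 g2 ->
  live (p := Piece L (Y :|: Z)) (f1 + f2) = live (p := Piece L' (Y' :|: Z')) (g1 + g2)
  /\ (f1 + f2 \in L) = (g1 + g2 \in L').

Definition glue_emb : emb (Piece L (Y :|: Z)) (Piece L' (Y' :|: Z')) :=
  (fun v => if v \in Y then d1.1 v else d2.1 v,
   fun w => if w \in Y' then d1.2 w else d2.2 w).

Lemma restr_split (W : finType) (A B : {set W}) (f : chain F W) : [disjoint A & B] ->
  f \in supp F (A :|: B) -> f = restr F A f + restr F B f.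
Proof.
move=> dis /mem_supp f0; apply/ffunP => -[v b]; rewrite ffunE !restrE.
case: (boolP (v \in A)) => vA; first by rewrite (disjointFr dis vA) addr0.
by rewrite add0r; case: ifPn => // vB; rewrite f0 // inE negb_or vA.
Qed.

Lemma suppU (W : finType) (A B : {set W}) (f g : chain F W) :
  f \in supp F A -> g \in supp F B -> f + g \in supp F (A :|: B).
Proof.
move=> /mem_supp fA /mem_supp gB; apply/mem_supp => v b; rewrite inE negb_or => /andP[vA vB].
by rewrite ffunE fA // gB // addr0.
Qed.

Lemma live_restr (W : finType) (K : {vspace chain F W}) (A B : {set W}) f :
  A \subset B -> live (p := Piece K B) f -> live (p := Piece K A) (restr F A f).
Proof. by move=> AB /memv_imgP[m mK ->]; rewrite /live /= restr_restr // memv_img. Qed.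

Lemma glue_im : [set (if v \in Y then d1.1 v else d2.1 v) | v in Y :|: Z] =
  (d1.1 @: Y) :|: (d2.1 @: Z).
Proof.
rewrite imsetU; congr (_ :|: _); apply: eq_in_imset => v vY /=; first by rewrite vY.
by rewrite (disjointFl YZ vY).
Qed.

Lemma ext_glue f1 f2 g1 g2 : ext d1 f1 g1 -> ext d2 f2 g2 ->
  ext glue_emb (f1 + f2) (g1 + g2).
Proof.
have sub1 := emb_sub e1; have sub2 := emb_sub e2.
move=> [/= f1Y g1Y fg1 g10] [/= f2Z g2Z fg2 g20].
split=> /=; [exact: suppU | exact: suppU | |].
  move=> v b vX; rewrite !ffunE; case: (boolP (v \in Y)) => vY.
    rewrite fg1 // (mem_supp _ _ f2Z) ?(disjointFr YZ vY) // (mem_supp _ _ g2Z) //.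
    by rewrite (disjointFr YZ') // (subsetP sub1) // imset_f.
  have vZ : v \in Z by move: vX; rewrite inE (negPf vY).
  rewrite fg2 // (mem_supp _ _ f1Y) // (mem_supp _ _ g1Y) //.
  by rewrite (disjointFl YZ') // (subsetP sub2) // imset_f.
move=> w wX; rewrite glue_im inE negb_or.
move=> /andP[wd1 wd2]; rewrite !ffunE; case: (boolP (w \in Y')) => wY.
  by rewrite g10 // (mem_supp _ _ g2Z) ?addr0 // (disjointFr YZ').
have wZ : w \in Z' by move: wX; rewrite inE (negPf wY).
by rewrite g20 // (mem_supp _ _ g1Y) ?addr0.
Qed.

Lemma ext_glue_inv f g : ext glue_emb f g ->
  ext d1 (restr F Y f) (restr F Y' g) /\ ext d2 (restr F Z f) (restr F Z' g).
Proof.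
have sub1 := emb_sub e1; have sub2 := emb_sub e2.
move=> [/= fX gX fg g0]; split; split; rewrite ?restr_supp //=.
- move=> v b vY; rewrite !restrE vY (subsetP sub1) ?imset_f //.
  by have := fg v b; rewrite inE vY => ->.
- move=> w wY wd; rewrite restrE wY; have := g0 w; rewrite inE wY => -> //.
  rewrite glue_im inE negb_or wd /=.
  by apply: contraL wY => /(subsetP sub2) wZ; rewrite (disjointFl YZ' wZ).
- move=> v b vZ; rewrite !restrE vZ (subsetP sub2) ?imset_f //.
  by have := fg v b; rewrite inE vZ orbT (disjointFl YZ vZ) => ->.
- move=> w wZ wd; rewrite restrE wZ; have := g0 w; rewrite inE wZ orbT.
  rewrite (disjointFl YZ' wZ) => -> //.
  rewrite glue_im inE negb_or wd andbT.
  by apply: contraL wZ => /(subsetP sub1) wY; rewrite (disjointFr YZ' wY).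
Qed.

Lemma embeds_glue : embeds glue_emb.
Proof.
have sub1 := emb_sub e1; have sub2 := emb_sub e2.
have splitL (W : finType) (K : {vspace chain F W}) (A B : {set W}) f : [disjoint A & B] ->
    live (p := Piece K (A :|: B)) f -> f = restr F A f + restr F B f.
  by move=> dis /live_supp; apply: restr_split.
split.
- move=> v w; rewrite !inE /= => vX wX.
  case: (boolP (v \in Y)) vX => [vY _|vY /= vZ]; case: (boolP (w \in Y)) wX => [wY _|wY /= wZ].
  + exact: (emb_inj e1).
  + move=> eqvw; have := subsetP sub1 _ (imset_f _ vY); rewrite eqvw.
    by rewrite (disjointFl YZ') // (subsetP sub2) // imset_f.
  + move=> eqvw; have := subsetP sub1 _ (imset_f _ wY); rewrite -eqvw.
    by rewrite (disjointFl YZ') // (subsetP sub2) // imset_f.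
  + exact: (emb_inj e2).
- by rewrite /= glue_im setUSS.
- move=> f fl; have f1l := live_restr (subsetUl Y Z) fl; have f2l := live_restr (subsetUr Y Z) fl.
  have [g1 g1l x1] := emb_live e1 f1l; have [g2 g2l x2] := emb_live e2 f2l.
  have [lv _] := compat f1l f2l g1l g2l x1 x2; rewrite (splitL _ _ _ _ _ YZ fl).
  exists (g1 + g2); last exact: ext_glue.
  by rewrite -lv -(splitL _ _ _ _ _ YZ fl).
- move=> f g x gl; have [x1 x2] := ext_glue_inv x.
  have g1l := live_restr (subsetUl Y' Z') gl; have g2l := live_restr (subsetUr Y' Z') gl.
  have f1l := emb_live_inv e1 x1 g1l; have f2l := emb_live_inv e2 x2 g2l.
  have [lv _] := compat f1l f2l g1l g2l x1 x2.
  by have [fX _ _ _] := x; rewrite (restr_split YZ fX) lv -(splitL _ _ _ _ _ YZ' gl).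
- move=> f g x fl gl; have [x1 x2] := ext_glue_inv x.
  have g1l := live_restr (subsetUl Y' Z') gl; have g2l := live_restr (subsetUr Y' Z') gl.
  have f1l := emb_live_inv e1 x1 g1l; have f2l := emb_live_inv e2 x2 g2l.
  have [_ mm] := compat f1l f2l g1l g2l x1 x2.
  by rewrite /= (splitL _ _ _ _ _ YZ fl) mm -(splitL _ _ _ _ _ YZ' gl).
- move=> h hl.
  have h1l := live_restr (subsetUl Y' Z') hl; have h2l := live_restr (subsetUr Y' Z') hl.
  have [f1 [g1 [f1l g1l x1 m1]]] := emb_onto e1 h1l.
  have [f2 [g2 [f2l g2l x2 m2]]] := emb_onto e2 h2l.
  have mem_hg : h - (g1 + g2) \in L'.
    rewrite (splitL _ _ _ _ _ YZ' hl) opprD addrACA; exact: memvD.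
  (* It differs from the live chain [h] by a member of [L'] supported on the union. *)
  have gl : live (p := Piece L' (Y' :|: Z')) (g1 + g2).
    have -> : g1 + g2 = h - (h - (g1 + g2)) by rewrite subKr.
    apply: liveB => //; apply: live_mem => //; apply: memvB; first exact: live_supp hl.
    exact: suppU (live_supp g1l) (live_supp g2l).
  exists (f1 + f2), (g1 + g2); split=> //; last exact: ext_glue.
  by have [-> _] := compat f1l f2l g1l g2l x1 x2.
Qed.

End Glue.

Section Chain.
Variables (p : nat -> piece F) (d : forall i, emb (p i) (p i.+1)).
Hypothesis ed : forall i, embeds (d i).

Fixpoint from i m : emb (p i) (p (m + i)) :=
  match m return emb (p i) (p (m + i)) with
  | 0 => (id, fun=> false)
  | m'.+1 => comp_emb (from i m') (d (m' + i))
  end.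

(** Defined apart because [from 0 i] ends in [p (i + 0)], which does not reduce to [p i]. *)
Fixpoint from0 i : emb (p 0) (p i) :=
  match i return emb (p 0) (p i) with
  | 0 => (id, fun=> false)
  | i'.+1 => comp_emb (from0 i') (d i')
  end.

Lemma embeds_from i m : embeds (from i m).
Proof. by elim: m => [|m IH]; [apply: embeds_id | apply: embeds_comp]. Qed.

Lemma embeds_from0 i : embeds (from0 i).
Proof. by elim: i => [|i IH]; [apply: embeds_id | apply: embeds_comp]. Qed.

Lemma ext_from i m f h : ext (from0 (m + i)) f h <->
  exists2 g, ext (from0 i) f g & ext (from i m) g h.
Proof.
elim: m h => [|m IH] h.
  split=> [x|[g x /ext_id[_ <-]]//]; exists h => //; apply/ext_id; split=> //.
  by case: x.
split.
  move=> /(ext_comp _ _ (embeds_from0 _) (ed _))[g' /IH[g x y] z].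
  by exists g => //; apply/(ext_comp _ _ (embeds_from _ _) (ed _)); exists g'.
move=> [g x /(ext_comp _ _ (embeds_from _ _) (ed _))[g' y z]].
by apply/(ext_comp _ _ (embeds_from0 _) (ed _)); exists g' => //; apply/IH; exists g.
Qed.

End Chain.
End Gluing.

(* Transporting the join of the parts [i] back to the parts [0] along the chains
   leaves finitely many possibilities, so two of them agree. *)
Lemma glue_chain (F : finFieldType) (V : nat -> finType)
    (L : forall i, {vspace chain F (V i)}) (Y Z : forall i, {set V i}) :
    (forall i, [disjoint Y i & Z i]) ->
    (forall i, ple (Piece (L i) (Y i)) (Piece (L i.+1) (Y i.+1))) ->
    (forall i, ple (Piece (L i) (Z i)) (Piece (L i.+1) (Z i.+1))) ->
  exists i j, (i < j)%N /\
    ple (Piece (L i) (Y i :|: Z i)) (Piece (L j) (Y j :|: Z j)).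
Proof.
move=> YZ leY leZ.
pose P i := Piece (L i) (Y i); pose Q i := Piece (L i) (Z i).
pose R i := Piece (L i) (Y i :|: Z i).
pose d i := sval (cid (leY i)); pose d' i := sval (cid (leZ i)).
have ed i : embeds (d i) by apply: svalP.
have ed' i : embeds (d' i) by apply: svalP.
pose ext2 i (x : chain F (V 0) * chain F (V 0)) (g : chain F (V i) * chain F (V i)) :=
  [/\ live (p := P i) g.1, live (p := Q i) g.2,
      ext (from0 (p := P) d i) x.1 g.1 & ext (from0 (p := Q) d' i) x.2 g.2].
(* Indexing by chains of the parts [0] gives one finite type for all [i], with no choice of class
   representatives. By [tableE] all transports of a live pair give the same entry. *)
pose T i : {ffun chain F (V 0) * chain F (V 0) -> bool * bool} := [ffun x =>
  (`[< exists2 g, ext2 i x g & live (p := R i) (g.1 + g.2) >],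
   `[< exists2 g, ext2 i x g & g.1 + g.2 \in L i >])].
have same i a b a' b' : live (p := P i) a -> live (p := P i) a' ->
    live (p := Q i) b -> live (p := Q i) b' -> a - a' \in L i -> b - b' \in L i ->
    live (p := R i) (a + b) = live (p := R i) (a' + b') /\
    (a + b \in L i) = (a' + b' \in L i).
  move=> al al' bl bl' aa bb.
  have -> : a + b = a' + b' + ((a - a') + (b - b')) by rewrite addrACA ![_ + (_ - _)]addrC !subrK.
  have m : (a - a') + (b - b') \in L i by apply: memvD.
  split; last by rewrite rpredDr.
  rewrite /live rpredDr //; apply: (live_mem (p := R i)) => //=; apply: suppU.
    exact: live_supp (liveB al al').
  exact: live_supp (liveB bl bl').
have tableE i x g : ext2 i x g -> live (p := P 0) x.1 -> live (p := Q 0) x.2 ->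
    T i x = (live (p := R i) (g.1 + g.2), g.1 + g.2 \in L i).
  move=> rg x1 x2; rewrite ffunE.
  have same_h h : ext2 i x h -> live (p := R i) (g.1 + g.2) = live (p := R i) (h.1 + h.2) /\
      (g.1 + g.2 \in L i) = (h.1 + h.2 \in L i).
    move=> [h1 h2 y1 y2]; have [g1 g2 z1 z2] := rg; apply: same => //.
      rewrite -[L i]/(pL (P i)) -(emb_mem (embeds_from0 ed i) (extB z1 y1))
        ?(liveB x1) ?(liveB g1) //.
      by rewrite subrr mem0v.
    rewrite -[L i]/(pL (Q i)) -(emb_mem (embeds_from0 ed' i) (extB z2 y2))
      ?(liveB x2) ?(liveB g2) //.
    by rewrite subrr mem0v.
  congr (_, _); apply/asboolP/idP.
  - by move=> [h /same_h[-> _]].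
  - by exists g.
  - by move=> [h /same_h[_ ->]].
  - by exists g.
have [i [j [ij eqT]]] := pigeonhole T.
exists i, j; split=> //; move: eqT; rewrite -(subnK (ltnW ij)); move: (j - i)%N => m eqT.
exists (glue_emb (from (p := P) d i m) (from (p := Q) d' i m)).
have em := embeds_from ed i m; have em' := embeds_from ed' i m.
apply: embeds_glue => // f1 f2 g1 g2 f1l f2l g1l g2l x1 x2.
(* [f1] and [f2] are replaced, within their classes, by transports of chains of the parts [0], where
   the equal tables decide. *)
have [h1 [f1' [h1l f1l' y1 m1]]] := emb_onto (embeds_from0 ed i) f1l.
have [h2 [f2' [h2l f2l' y2 m2]]] := emb_onto (embeds_from0 ed' i) f2l.
have [g1' g1l' z1] := emb_live em f1l'; have [g2' g2l' z2] := emb_live em' f2l'.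
have n1 : g1 - g1' \in L (m + i)%N.
  by rewrite -[L _]/(pL (P (m + i)%N)) -(emb_mem em (extB x1 z1)) //; apply: liveB.
have n2 : g2 - g2' \in L (m + i)%N.
  by rewrite -[L _]/(pL (Q (m + i)%N)) -(emb_mem em' (extB x2 z2)) //; apply: liveB.
have [-> ->] := same _ _ _ _ _ f1l f1l' f2l f2l' m1 m2.
have [-> ->] := same _ _ _ _ _ g1l g1l' g2l g2l' n1 n2.
have rf : ext2 i (h1, h2) (f1', f2') by split.
have rg : ext2 (m + i)%N (h1, h2) (g1', g2').
  by split=> //; apply/ext_from => //=; [exists f1' | exists f2'].
by have := tableE _ _ _ rf h1l h2l; rewrite eqT (tableE _ _ _ rg) // => -[-> ->].
Qed.

(** * Parts with at most one element *)

Section SmallPieces.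
Variable F : finFieldType.
Implicit Types p q : piece F.

Definition single (V : finType) (v : V) (x : F * F) : chain F V :=
  [ffun i => if i.1 == v then (if i.2 then x.2 else x.1) else 0].

(* The first component is needed because an embedding of empty parts still
   carries a map between the ground sets. *)
Definition small_type p : bool * option ({set F * F} * {set F * F}) :=
  (#|pV p| == 0, omap (fun v => ([set x | live (p := p) (single v x)],
                                [set x | single v x \in pL p])) [pick v in pX p]).

Lemma supp0 (V : finType) (f : chain F V) : f \in supp F set0 -> f = 0.
Proof. by move=> /mem_supp f0; apply/ffunP => -[v b]; rewrite ffunE f0 // inE. Qed.

Lemma supp1 (V : finType) (v : V) (f : chain F V) :
  f \in supp F [set v] -> f = single v (f (v, false), f (v, true)).
Proof.
move=> /mem_supp f0; apply/ffunP => -[w b]; rewrite ffunE /=.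
by case: eqVneq => [->|wv]; [case: b | apply: f0; rewrite inE].
Qed.

Lemma live0 p : live (p := p) 0.
Proof. exact: mem0v. Qed.

Lemma ple_small p q : (#|pX p| <= 1)%N -> (#|pX q| <= 1)%N ->
  small_type p = small_type q -> ple p q.
Proof.
rewrite /small_type => cp cq [eqV].
case: pickP => [v vX|pX0]; case: pickP => [w wX|qX0] //=.
  have eX : pX p = [set v].
    by apply/eqP; rewrite eq_sym eqEcard sub1set vX cards1.
  have eX' : pX q = [set w].
    by apply/eqP; rewrite eq_sym eqEcard sub1set wX cards1.
  move=> [/setP lv /setP mm]; exists (fun=> w, fun=> false).
  have im : [set (fun=> w) x | x in pX p] = [set w] by rewrite eX imset_set1.
  have extE f g : ext (p := p) (q := q) (fun=> w, fun=> false) f g <->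
      exists x, f = single v x /\ g = single w x.
    split=> [[fX gX fg _]|[x [-> ->]]].
      exists (f (v, false), f (v, true)); rewrite eX in fX; rewrite eX' in gX.
      by rewrite -(supp1 fX) (supp1 gX) -!fg ?eX ?inE.
    split; rewrite ?eX ?eX'.
    - by apply/mem_supp => u b; rewrite inE ffunE => /negPf->.
    - by apply/mem_supp => u b; rewrite inE ffunE => /negPf->.
    - by move=> u b; rewrite inE => /eqP->; rewrite !ffunE /= !eqxx.
    - by move=> u; rewrite /= -eX im => ->.
  have lvE x : live (p := p) (single v x) = live (p := q) (single w x).
    by have := lv x; rewrite !inE.
  have mmE x : (single v x \in pL p) = (single w x \in pL q).
    by have := mm x; rewrite !inE.
  have liveE (r : piece F) u f : pX r = [set u] -> live (p := r) f -> exists x, f = single u x.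
    by move=> er /live_supp; rewrite er => /supp1->; eexists.
  split=> /=.
  - by move=> x y; rewrite eX !inE => /eqP-> /eqP->.
  - by rewrite im eX'.
  - move=> f fl; have [x ef] := liveE _ _ _ eX fl; exists (single w x); first by rewrite -lvE -ef.
    by apply/extE; exists x.
  - by move=> f g /extE[x [-> ->]]; rewrite lvE.
  - by move=> f g /extE[x [-> ->]].
  - move=> h hl; have [x eh] := liveE _ _ _ eX' hl; rewrite eh in hl *.
    exists (single v x), (single w x); split=> //; first by rewrite lvE.
      by apply/extE; exists x.
    by rewrite subrr mem0v.
move=> _; have e0 (r : piece F) : (forall x, (x \in pX r) = false) -> pX r = set0.
  by move=> r0; apply/setP => x; rewrite r0 inE.
have eX := e0 p pX0; have eX' := e0 q qX0.
have [h] : exists h : pV p -> pV q, True.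
  case: (set_0Vmem [set: pV q]) => [/eqP|[w _]]; last by exists (fun=> w).
  rewrite -cards_eq0 cardsT -eqV => /eqP c0.
  have none (v : pV p) : False by have : v \in pV p by []; rewrite (card0_eq c0 v).
  by exists (fun v => False_rect _ (none v)).
move=> _ ; exists (h, fun=> false).
have live0E (r : piece F) f : pX r = set0 -> live (p := r) f -> f = 0.
  by move=> er /live_supp; rewrite er; apply: supp0.
have ext0 f g : ext (p := p) (q := q) (h, fun=> false) f g <-> f = 0 /\ g = 0.
  split=> [[]|[-> ->]]; first by rewrite eX eX' => /supp0-> /supp0->.
  split; rewrite ?mem0v //; first by move=> v b; rewrite eX inE.
  by move=> w; rewrite eX' inE.
split=> /=.
- by move=> x y; rewrite eX inE.
- by rewrite eX imset0 sub0set.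
- by move=> f /(live0E _ _ eX)->; exists 0; [apply: live0 | apply/ext0].
- by move=> f g /ext0[-> _] _; apply: live0.
- by move=> f g /ext0[-> ->]; rewrite !mem0v.
- move=> g /(live0E _ _ eX')->; exists 0, 0; split; rewrite ?subr0 ?mem0v //; try exact: live0.
  exact/ext0.
Qed.

End SmallPieces.

(** * The space of a matrix: connectivity and feasible sets *)

Section MatrixChains.
Variables (F : fieldType) (V : finType) (A : V -> V -> F).

Definition row_chain (x : {ffun V -> F^o}) : chain F V :=
  [ffun i => if i.2 then \sum_u x u * A u i.1 else x i.1].

Lemma row_chain_is_linear : linear row_chain.
Proof.
move=> a x y; apply/ffunP => -[v b]; rewrite !ffunE; case: b => //=.
rewrite scaler_sumr -big_split; apply: eq_bigr => u _.
by rewrite !ffunE mulrDl -scalerAl.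
Qed.

HB.instance Definition _ := GRing.isLinear.Build F {ffun V -> F^o} (chain F V) _
  row_chain row_chain_is_linear.

Definition mat_chain : {vspace chain F V} := limg (linfun row_chain).

Lemma mem_mat_chain (f : chain F V) :
  reflect (forall v, f (v, true) = \sum_u f (u, false) * A u v) (f \in mat_chain).
Proof.
apply: (iffP memv_imgP) => [[x _ ->] v|fA].
  by rewrite lfunE !ffunE; apply: eq_bigr => u _; rewrite !ffunE.
exists [ffun v => f (v, false)]; first exact: memvf.
rewrite lfunE; apply/ffunP => -[v []]; rewrite !ffunE // fA.
by apply: eq_bigr => u _; rewrite ffunE.
Qed.

Lemma dim_mat_chain : \dim mat_chain = #|V|.
Proof.
rewrite limg_dim_eq; first by rewrite dimvf /dim /= muln1.
apply/eqP; rewrite -subv0; apply/subvP => x; rewrite memv_cap memv_ker memv0 lfunE.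
move=> /andP[_ /eqP x0]; apply/eqP/ffunP => v.
by have := congr1 (fun f : chain F V => f (v, false)) x0; rewrite /= !ffunE.
Qed.

Lemma mat_chain_lagrangian : skew_symmetric A \/ symmetric_matrix A -> lagrangian mat_chain.
Proof.
move=> symA; split; first exact: dim_mat_chain.
have [e e0 eA] : exists2 e : F, e != 0 & forall u v, A u v + e * A v u = 0.
  case: symA => [[sk _]|sy]; last first.
    by exists (-1) => [|u v]; rewrite ?oppr_eq0 ?oner_eq0 // (sy u v) mulN1r subrr.
  by exists 1 => [|u v]; rewrite ?oner_eq0 // (sk u v) mul1r addNr.
exists e => // f g /mem_mat_chain fA /mem_mat_chain gA.
rewrite /form big_split /= -mulr_sumr.
under eq_bigr do rewrite gA mulr_sumr.
under [X in _ + e * X]eq_bigr do rewrite fA mulr_suml.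
rewrite [X in _ + e * X]exchange_big /= mulr_sumr -big_split big1 // => v _.
rewrite mulr_sumr -big_split big1 // => u _ /=.
transitivity (f (v, false) * g (u, false) * (A u v + e * A v u)); first by ring.
by rewrite eA mulr0.
Qed.

(** This is [row_chain] of [u] extended by zero outside [X]. *)
Definition sub_chain (X : {set V}) (u : 'rV[F]_#|X|) : chain F V :=
  [ffun i => if i.2 then \sum_j u 0 j * A (enum_val j) i.1
             else \sum_j u 0 j *+ (enum_val j == i.1)].

Lemma sub_chain_false X u j : sub_chain (X := X) u (enum_val j, false) = u 0 j.
Proof.
rewrite ffunE /= (bigD1 j) //= eqxx mulr1n big1 ?addr0 // => i ij.
by rewrite (inj_eq enum_val_inj) (negPf ij).
Qed.

Lemma sub_chain_out (X : {set V}) u v : v \notin X -> sub_chain (X := X) u (v, false) = 0.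
Proof.
move=> vX; rewrite ffunE /= big1 // => j _; case: eqP => // ej.
by rewrite -ej enum_valP in vX.
Qed.

Lemma sub_chain_mem X u : sub_chain (X := X) u \in mat_chain.
Proof.
apply/mem_mat_chain => v; rewrite (bigID (mem X)) /= [X in _ + X]big1 ?addr0; last first.
  by move=> w wX; rewrite sub_chain_out // mul0r.
by rewrite big_enum_val ffunE; apply: eq_bigr => j _; rewrite sub_chain_false.
Qed.

(** Extended by zero, independent vectors of the left kernel of [submatrix A X (~: X)] give
    independent members of [mat_chain] supported on [X]. *)
Lemma conn_mat_chain (X : {set V}) : (conn mat_chain X <= \rank (submatrix A X (~: X)))%N.
Proof.
set M := submatrix A X (~: X).
have [B freeB Bker] : exists2 B : 'M_(\rank (kermx M), #|X|),
    row_free B & forall i, row i B *m M = 0.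
  exists (row_base (kermx M)) => [|i]; first exact: row_base_free.
  by apply/sub_kermxP; apply: submx_trans (row_sub _ _) _; rewrite eq_row_base.
pose s := [tuple sub_chain (row i B) | i < \rank (kermx M)].
have sE (k : 'I_(\rank (kermx M))) : s`_k = sub_chain (row k B) by rewrite -tnth_nth tnth_mktuple.
have fs : free s.
  apply/freeP => a a0 i; pose u := \row_j a j.
  suff : u = 0 by move/rowP/(_ i); rewrite !mxE.
  apply: (row_free_inj freeB); rewrite mul0mx; apply/rowP => j; rewrite !mxE.
  have := congr1 (fun f : chain F V => f (enum_val j, false)) a0.
  rewrite /= sum_ffunE ffunE => a1; rewrite -[RHS]a1; apply: eq_bigr => k _.
  by rewrite ffunE sE sub_chain_false !mxE.
have sub : (<<s>> <= mat_chain :&: supp F X)%VS.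
  apply/span_subvP => _ /mapP[i _ ->]; rewrite memv_cap sub_chain_mem; apply/mem_supp => v b vX.
  case: b; last exact: sub_chain_out.
  have vC : v \in ~: X by rewrite inE.
  have := congr1 (fun N : 'rV_ _ => N 0 (enum_rank_in vC v)) (Bker i).
  rewrite /= !mxE ffunE /= => {2}<-.
  by apply: eq_bigr => j _; rewrite !mxE enum_rankK_in.
have := dimvS sub; move: fs; rewrite /free size_tuple => /eqP ->.
by rewrite mxrank_ker /conn !leq_subLR addnC.
Qed.

(** A left kernel vector of [submatrix A X X], extended by zero, is a chain whose first coordinate
    vanishes off [X] and whose second vanishes on [X]. Feasibility is thus expressed by the space
    and one chosen coordinate per element, the same data that define minors. *)
Lemma matrix_feasibleP (X : {set V}) : reflect
  (forall f : chain F V, f \in mat_chain -> (forall v, f (v, v \in X) = 0) -> f = 0)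
  (X \in matrix_feasible A).
Proof.
rewrite inE -row_free_unit; apply: (iffP idP) => [free f /mem_mat_chain fA f0|noker].
  pose u := \row_j f (enum_val (A := mem X) j, false).
  have fX v : v \notin X -> f (v, false) = 0 by move=> /negPf vX; have := f0 v; rewrite vX.
  have u0 : u = 0.
    apply: (row_free_inj free); rewrite mul0mx; apply/rowP => j; rewrite !mxE.
    have := f0 (enum_val j); rewrite enum_valP fA => {2}<-.
    rewrite [RHS](bigID (mem X)) /= [X in _ = _ + X]big1 ?addr0 => [|w wX];
      last by rewrite fX ?mul0r.
    by rewrite [RHS]big_enum_val; apply: eq_bigr => i _; rewrite !mxE.
  have f00 v : f (v, false) = 0.
    case: (boolP (v \in X)) => vX; last exact: fX.
    by have := congr1 (fun N : 'rV_ _ => N 0 (enum_rank_in vX v)) u0; rewrite !mxE enum_rankK_in.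
  apply/ffunP => -[v []]; rewrite ffunE // fA big1 // => w _.
  by rewrite f00 mul0r.
apply: inj_row_free => u uM; apply/rowP => j; rewrite mxE -(sub_chain_false u).
rewrite (noker (sub_chain u)) ?ffunE ?sub_chain_mem // => v.
case: (boolP (v \in X)) => vX; last exact: sub_chain_out.
have := congr1 (fun N : 'rV_ _ => N 0 (enum_rank_in vX v)) uM; rewrite /= !mxE ffunE /= => {2}<-.
by apply: eq_bigr => k _; rewrite !mxE enum_rankK_in.
Qed.

End MatrixChains.

(** * Minors whose restriction map is injective *)

Section Nondegenerate.
Variables (F : fieldType) (V : finType) (L : {vspace chain F V}) (S : {set V}).
Hypothesis lagL : lagrangian L.

(* If [w] is supported on [S] and vanishes at the coordinates [c], isotropy with
   [w] makes both coordinates at [v] interchangeable. *)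
Lemma flip_minor_chain c w v : w \in (L :&: zero_on F S c :&: supp F S)%VS ->
    w (v, ~~ c v) != 0 ->
  let c' u := if u == v then ~~ c u else c u in
  minor_chain L S c' = minor_chain L S c /\
  (\dim (L :&: zero_on F S c' :&: supp F S) < \dim (L :&: zero_on F S c :&: supp F S))%N.
Proof.
have [_ [e e0 iso]] := lagL.
move=> wW wv c'; have := wW; rewrite !memv_cap => /andP[/andP[wL /mem_zero_on w0] /mem_supp wS].
have vS : v \in S by apply: contraNT wv => vS; rewrite wS.
have c'v : c' v = ~~ c v by rewrite /c' eqxx.
have c'n u : u != v -> c' u = c u by rewrite /c' => /negPf->.
have zero' f : f \in L -> f \in zero_on F S c' -> f \in zero_on F S c.
  move=> fL /mem_zero_on f0; apply/mem_zero_on => u uS.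
  have [->|uv] := eqVneq u v; last by rewrite -c'n // f0.
  have := iso f w fL wL; rewrite /form (bigD1 v) //= big1 ?addr0.
    have := w0 v vS; case: (c v) wv => /= wv ->; rewrite !mulr0 ?add0r ?addr0 => /eqP.
      by rewrite !mulf_eq0 (negPf e0) (negPf wv) orbF => /eqP.
    by rewrite mulf_eq0 (negPf wv) orbF => /eqP.
  move=> x xv; case: (boolP (x \in S)) => xS; last by rewrite !wS // !mulr0 addr0.
  have := w0 x xS; have := f0 x xS; rewrite c'n //.
  by case: (c x) => -> ->; rewrite ?mulr0 ?mul0r ?mulr0 addr0.
split.
  apply/vspaceP => f; apply/memv_imgP/memv_imgP => -[g + ->]; rewrite memv_cap => /andP[gL g0].
    by exists g => //; rewrite memv_cap gL zero'.
  exists (g - (g (v, ~~ c v) / w (v, ~~ c v)) *: w).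
    rewrite memv_cap memvB ?memvZ //=; apply/mem_zero_on => u uS; rewrite !ffunE.
    have [->|uv] := eqVneq u v; first by rewrite c'v /GRing.scale /= divfK // subrr.
    by rewrite c'n // w0 // scaler0 subr0 (mem_zero_on _ _ _ g0).
  apply/ffunP => -[u b]; rewrite !restrE inE; case: (boolP (u \in S)) => //= uS.
  by rewrite !ffunE (wS u b) // scaler0 subr0.
have sub : (L :&: zero_on F S c' :&: supp F S <= L :&: zero_on F S c :&: supp F S)%VS.
  apply/subvP => f; rewrite !memv_cap => /andP[/andP[fL f0] ->].
  by rewrite fL zero'.
rewrite (ltn_leqif (dimv_leqif_sup sub)); apply/negP => /subvP/(_ w wW).
rewrite !memv_cap => /andP[/andP[_ /mem_zero_on/(_ v vS) wv0] _].
by rewrite c'v in wv0; rewrite wv0 eqxx in wv.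
Qed.

(** For the space of a matrix, a nonzero chain supported on [S] and vanishing at the coordinates [c]
    would leave the corresponding deletion without feasible sets. Flipping choices removes such
    chains and keeps the minor. *)
Lemma nondegenerate_minor c : exists c', minor_chain L S c' = minor_chain L S c /\
  (L :&: zero_on F S c' :&: supp F S = 0)%VS.
Proof.
have [|c' eqc' minc'] := @ex_minimal _ (fun c' => minor_chain L S c' = minor_chain L S c)
  (fun c' => \dim (L :&: zero_on F S c' :&: supp F S)); first by exists c.
exists c'; split=> //; apply/eqP; rewrite -subv0; apply/subvP => w wW.
rewrite memv0; apply/eqP/ffunP => -[v b]; rewrite ffunE; apply: contrapT => /eqP wv.
have := wW; rewrite !memv_cap => /andP[/andP[_ /mem_zero_on w0] /mem_supp wS].
have vS : v \in S by apply: contraNT wv => vS; rewrite wS.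
have wv' : w (v, ~~ c' v) != 0.
  by move: wv (w0 v vS); case: b; case: (c' v) => //= /negP + /eqP.
have [eqc lt] := flip_minor_chain wW wv'.
by have := minc' _ (etrans eqc eqc'); rewrite leqNgt lt.
Qed.

End Nondegenerate.

Local Close Scope ring_scope.

(** * Branch-width and minors *)

Section Forest.
Variables (F : finFieldType) (V : nat -> finType) (k : nat).
Variables (L : forall i, {vspace chain F (V i)}) (T : forall i, dtree (V i)).
Hypothesis lagL : forall i, lagrangian (L i).
Hypothesis validT : forall i, dvalid (T i).
Hypothesis widthT : forall i, all (fun X => conn (L i) X <= k) (dsets (T i)).
Hypothesis linkedT : forall i C D tf, T i = plug C (plug D tf) ->
  all (fun X => conn (L i) (dset tf) <= conn (L i) X) (path_sets D tf) ->
  forall Z : {set V i}, dset tf \subset Z -> Z \subset dset (plug D tf) ->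
  conn (L i) (dset tf) <= conn (L i) Z.

(** An edge is represented by the index of its tree and the subtree below it. *)
Definition fedge := {i : nat & dtree (V i)}.
Implicit Types e f : fedge.

Definition fpiece e := Piece (L (tag e)) (dset (tagged e)).
Definition flab e := conn (L (tag e)) (dset (tagged e)).

Fixpoint dsize (W : finType) (t : dtree W) :=
  if t is DNode l r then (dsize l + dsize r).+1 else 1.
Definition fsize e := dsize (tagged e).

(** A leaf is its own child by default; [finner] keeps this case out of the tree lemma. *)
Definition dleft (W : finType) (t : dtree W) := if t is DNode l _ then l else t.
Definition dright (W : finType) (t : dtree W) := if t is DNode _ r then r else t.
Definition dnode (W : finType) (t : dtree W) := if t is DNode _ _ then true else false.

Definition fleft e : fedge := Tagged (fun i => dtree (V i)) (dleft (tagged e)).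
Definition fright e : fedge := Tagged (fun i => dtree (V i)) (dright (tagged e)).

Definition fvalid e := exists C, T (tag e) = plug C (tagged e).
Definition finner e := fvalid e /\ dnode (tagged e).

Lemma plug_cat (W : finType) (C D : seq (bool * dtree W)) t :
  plug (C ++ D) t = plug C (plug D t).
Proof. by elim: C => //= -[b h] C ->. Qed.

Lemma path_sets_cat (W : finType) (C D : seq (bool * dtree W)) t a :
  all a (path_sets C (plug D t)) -> all a (path_sets D t) -> all a (path_sets (C ++ D) t).
Proof.
elim: C => [|[b h] C IH] //= /andP[ah aC] aD.
by rewrite plug_cat ah; apply: IH.
Qed.

Lemma fchild_plug i (t : dtree (V i)) f : dnode t ->
    child fleft fright (Tagged (fun i => dtree (V i)) t) f ->
  exists b h tf, f = Tagged (fun i => dtree (V i)) tf /\ t = plug [:: (b, h)] tf.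
Proof.
case: t => [//|l r] _ [] ->; first by exists false, r, l.
by exists true, l, r.
Qed.

Lemma fdescendant_plug n e f :
    descendant fleft fright (fun g => finner g /\ n <= flab g) e f ->
  exists D tf, [/\ f = Tagged (fun i => dtree (V i)) (tf : dtree (V (tag e))),
    tagged e = plug D tf & all (fun X => n <= conn (L (tag e)) X) (path_sets D tf)].
Proof.
elim=> [[i t] {}f [[_ ne] le] [_ lf] c|{}e {}f g _ [D [tf [eqf eqe pD]]] [_ lg] c'].
  have [b [h [tf [eqf eqe]]]] := fchild_plug ne c; exists [:: (b, h)], tf; split=> //.
  rewrite /= -(dset_plug_cons b h [::] tf) -eqe [X in X && _]le /=.
  by move: lf; rewrite eqf /flab /= andbT.
subst f; case/boolP: (dnode tf) => ntf; last first.
  have eqg : g = Tagged (fun i => dtree (V i)) (tf : dtree (V (tag e))).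
    by case: tf ntf c' {eqe pD} => // A _ []; apply.
  by exists D, tf.
have [b [h [tg [eqg eqf]]]] := fchild_plug ntf c'.
exists (D ++ [:: (b, h)]), tg; split=> //; first by rewrite plug_cat -eqf.
apply: path_sets_cat; first by rewrite -eqf.
rewrite /= -(dset_plug_cons b h [::] tg) -eqf andbT; apply/andP; split; last first.
  by move: lg; rewrite eqg.
have /allP := pD; apply; elim: (D) => [|[b' h'] D' IH] /=; first by rewrite inE.
by rewrite inE IH orbT.
Qed.

Lemma forest_good : exists i j, i < j /\
  ple (Piece (L i) (dset (T i))) (Piece (L j) (dset (T j))).
Proof.
pose le e f := ple (fpiece e) (fpiece f).
pose base e := fvalid e /\ ~~ dnode (tagged e).
have valid_dvalid e : fvalid e -> dvalid (tagged e).
  by case=> C eqT; apply: (@dvalid_plugr _ C); rewrite -eqT.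
have child_valid e f : finner e -> child fleft fright e f -> fvalid f.
  case: e => i t [[C /= eqT] ne] /(fchild_plug ne)[b [h [tf [-> eqe]]]].
  by exists (C ++ [:: (b, h)]); rewrite /= plug_cat -eqe.
have wbase : wqo_on le base.
  move=> s bs; have [i [j [ij eqt]]] := pigeonhole (fun n => small_type (fpiece (s n))).
  exists i, j; split=> //; apply: ple_small eqt => //=.
    by case: (bs i) => /valid_dvalid + ; case: (tagged (s i)).
  by case: (bs j) => /valid_dvalid + ; case: (tagged (s j)).
have wqo : wqo_on le (fun e => finner e \/ base e).
  (* The labels [0] to [k] take [k.+1] rounds of the induction. *)
  apply: (@wqo_on_forest _ le flab fsize fleft fright finner k _ _ _ _ _ k.+1 0) => //.
  - by move=> e f g; apply: ple_trans.
  - by move=> [i [A|l r]] f [_] // _ [] ->; rewrite /fsize /= ltnS ?leq_addr ?leq_addl.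
  - move=> e [[C eqT] _]; have := widthT (tag e); rewrite eqT all_dsets_plug => /and3P[_ _].
    by rewrite /flab; case: (tagged e) => [B|l r] /andP[].
  - move=> e f d eqlab; have [D [tf [eqf eqe pD]]] := fdescendant_plug d.
    have [C eqT] : fvalid e by elim: d {eqlab D tf eqf eqe pD} => [? ? [[]]|].
    subst f; rewrite /le /fpiece /= eqe; rewrite /flab /= eqe in eqlab.
    rewrite eqe in eqT; apply: linked_ple (lagL _) (dset_plug_sub _ _) (esym eqlab) _.
    by apply: linkedT eqT _; move: pD; rewrite /flab eqe -eqlab.
  - move=> s inn leL leR.
    have eqd i : dset (tagged (s i)) = dset (dleft (tagged (s i))) :|: dset (dright (tagged (s i))).
      by case: (inn i) => _; case: (tagged (s i)).
    have [|||i [j [ij leij]]] := @glue_chain F (fun i => V (tag (s i))) (fun i => L (tag (s i)))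
      (fun i => dset (dleft (tagged (s i)))) (fun i => dset (dright (tagged (s i)))).
    + by move=> i; case: (inn i) => /valid_dvalid; case: (tagged (s i)) => //= l r /and3P[].
    + by move=> i; apply: leL.
    + by move=> i; apply: leR.
    exists i, j; split=> //.
    by rewrite /le /fpiece !eqd.
  - move=> e f ie c; have vf := child_valid _ _ ie c.
    by case/boolP: (dnode (tagged f)) => nf; [left | right].
have [|i [j [ij leij]]] := wqo (fun i => Tagged (fun i => dtree (V i)) (T i)).
  move=> i; have vi : fvalid (Tagged (fun i => dtree (V i)) (T i)) by exists [::].
  by case/boolP: (dnode (T i)) => ni; [left | right].
by exists i, j.
Qed.

End Forest.

(** * From embeddings back to minors of delta-matroids *)

Section FromEmbeddingToMinor.

Lemma in_symdiff (V : finType) (X Y : {set V}) x :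
  (x \in symdiff X Y) = (x \in X) (+) (x \in Y).
Proof. by rewrite !inE; case: (x \in X); case: (x \in Y). Qed.

Lemma in_twist (V : finType) (Fs : {set {set V}}) (X Y : {set V}) :
  (Y \in twist Fs X) = (symdiff Y X \in Fs).
Proof.
have symdiffK Z : symdiff (symdiff Z X) X = Z.
  by apply/setP => x; rewrite !in_symdiff addbK.
apply/imsetP/idP => [[Z ZF ->]|YX]; first by rewrite symdiffK.
by exists (symdiff Y X); rewrite ?symdiffK.
Qed.

Variables (F : fieldType) (V V' : finType) (A : V -> V -> F) (A' : V' -> V' -> F).
Hypothesis symA' : skew_symmetric A' \/ symmetric_matrix A'.

Lemma ple_feasible : ple (Piece (mat_chain A) setT) (Piece (mat_chain A') setT) ->
  exists2 h : V -> V', injective h & exists C : {set V'},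
    (forall v, h v \notin C) /\
    forall X, (X \in matrix_feasible A) = (h @: X :|: C \in matrix_feasible A').
Proof.
move=> [[h c] [/= inj _ lv lvi mm _]].
have hinj : injective h by move=> v w; apply: inj; rewrite inE.
have liveE (W : finType) (K : {vspace chain F W}) (f : chain F W) :
    live (p := Piece K setT) f = (f \in K).
  have sT g : g \in supp F [set: W] by apply/mem_supp => v b; rewrite inE.
  apply/memv_imgP/idP => [[g gK ->]|fK]; first by rewrite restr_id.
  by exists f; rewrite ?restr_id.
pose S := ~: (h @: setT).
have hS v : h v \notin S by rewrite inE negbK imset_f.
have Sh w : w \notin S -> exists v, w = h v by rewrite inE negbK => /imsetP[v _ ->]; exists v.
(* Along [h], the space of [A] is the minor of the space of [A'] given by the choice [c]. *)
have memA f : f \in mat_chain A <->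
    exists2 g, g \in minor_chain (mat_chain A') S c & forall v b, g (h v, b) = f (v, b).
  split.
    rewrite -liveE => /lv[g gl [_ _ gf g0]]; exists (restr F (~: S) g).
      apply: memv_img; rewrite memv_cap -liveE gl; apply/mem_zero_on => w wS.
      by apply: g0; rewrite ?inE //; move: wS; rewrite inE.
    by move=> v b; rewrite restrE inE hS gf // inE.
  move=> [_ /memv_imgP[g + ->] gf]; rewrite memv_cap => /andP[gL /mem_zero_on g0].
  rewrite -liveE; apply: (lvi _ g); last by rewrite liveE.
  split; try by apply/mem_supp => v b; rewrite inE.
    by move=> v b _; rewrite -gf restrE inE hS.
  by move=> w _ wh; apply: g0; rewrite inE.
have [c' [eqc' nondeg]] := nondegenerate_minor S (mat_chain_lagrangian symA') c.
rewrite -eqc' in memA.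
exists h => //; exists [set w in S | c' w]; split=> [v|X]; first by rewrite inE (negPf (hS v)).
set X' := _ :|: _.
have X'h v : (h v \in X') = (v \in X).
  by rewrite 2!inE (mem_imset _ _ hinj) (negPf (hS v)) orbF.
have X'S w : w \in S -> (w \in X') = c' w.
  move=> wS; rewrite in_setU in_set wS /=; case: imsetP => // -[v _ ew].
  by move: (hS v); rewrite -ew wS.
apply/matrix_feasibleP/matrix_feasibleP => feas.
  move=> g gL g0; pose f : chain F V := [ffun i => g (h i.1, i.2)].
  have gz : g \in zero_on F S c' by apply/mem_zero_on => w wS; rewrite -X'S.
  have f0 : f = 0%R.
    apply: feas => [|v]; last by rewrite ffunE /= -X'h.
    apply/memA; exists (restr F (~: S) g); first by apply: memv_img; rewrite memv_cap gL.
    by move=> v b; rewrite restrE inE hS ffunE.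
  (* As [f] is zero, [g] is supported on [S] and vanishes at the coordinates [c'], so it is zero by
     nondegeneracy. *)
  apply/eqP; rewrite -memv0 -nondeg !memv_cap gL gz; apply/mem_supp => w b wS.
  have [v ->] := Sh w wS.
  by have := congr1 (fun f : chain F V => f (v, b)) f0; rewrite /= !ffunE.
move=> f /memA[_ /memv_imgP[g + ->] gf] f0; rewrite memv_cap => /andP[gL /mem_zero_on gz].
have gf' v b : g (h v, b) = f (v, b) by rewrite -gf restrE inE hS.
suff g0 : g = 0%R by apply/ffunP => -[v b]; rewrite -gf' g0 !ffunE.
apply: feas => // w; case: (boolP (w \in S)) => wS; first by rewrite X'S // gz.
by have [v ->] := Sh w wS; rewrite X'h gf' f0.
Qed.

Lemma isomorphic_minor (Fs : {set {set V}}) (Fs' : {set {set V'}}) :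
    Fs != set0 -> equivalent Fs (matrix_feasible A) -> equivalent Fs' (matrix_feasible A') ->
    ple (Piece (mat_chain A) setT) (Piece (mat_chain A') setT) ->
  exists (U : finType) (N : {set {set U}}), minor Fs' N /\ isomorphic Fs N.
Proof.
move=> Fs0 [X eqFs] [X' eqFs'] /ple_feasible[h hinj [C [hC feas]]].
(* In [B], [X'] undoes the twist of [Fs'], [C] makes the deletion of [S] select the sets meeting [S]
   in [C], and [h @: X] restores the twist of [Fs]. *)
pose S := ~: (h @: setT); pose B := symdiff (symdiff (h @: X) C) X'.
have hS v : h v \notin S by rewrite inE negbK imset_f.
pose f v : {x | x \notin S} := Sub (h v) (hS v).
have finj : injective f by move=> v w [] /hinj.
have bijf : bijective f.
  apply: inj_card_bij finj _; rewrite card_sig; apply: leq_trans (_ : #|h @: setT| <= _).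
    by apply/subset_leq_card/subsetP => x; rewrite !inE negbK.
  by rewrite card_imset // cardsT.
have memN (Y : {set V}) : (f @: Y \in deletion (twist Fs' B) S) = (Y \in Fs).
  rewrite inE eqFs eqFs' !in_twist feas -imset_comp.
  rewrite (_ : symdiff _ X' = h @: symdiff Y X :|: C) //.
  apply/setP => w; rewrite !in_symdiff in_setU.
  rewrite (eq_imset _ (_ : _ =1 h)) //.
  have -> : (w \in h @: symdiff Y X) = (w \in h @: Y) (+) (w \in h @: X).
    case: (boolP (w \in h @: setT)) => [/imsetP[v _ ->]|wh].
      by rewrite !(mem_imset _ _ hinj) in_symdiff.
    have no (Z : {set V}) : (w \in h @: Z) = false.
      by apply: contraNF wh; apply/subsetP/imsetS/subsetT.
    by rewrite !no.
  have : ~~ ((w \in h @: setT) && (w \in C)).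
    by apply/negP => /andP[/imsetP[v _ ->]]; rewrite (negPf (hC v)).
  have no (Z : {set V}) : w \in h @: Z -> w \in h @: setT.
    by apply/subsetP/imsetS/subsetT.
  move: (no Y) (no X); case: (w \in h @: setT) => /=.
    by move=> _ _ /negPf->; rewrite orbF addbF addbA addbK.
  move=> nY nX _; have -> : (w \in h @: Y) = false by apply/negP => /nY.
  have -> : (w \in h @: X) = false by apply/negP => /nX.
  by case: (w \in C); case: (w \in X').
exists {x | x \notin S}, (deletion (twist Fs' B) S); split; last by exists f.
apply: minor_deletion; first by apply: minor_twist; apply: minor_refl.
have [Y YF] := set0Pn _ Fs0; apply/set0Pn; exists (f @: Y).
by rewrite memN.
Qed.

End FromEmbeddingToMinor.

Lemma conn_edge_side (F : fieldType) (V : finType) (A : V -> V -> F)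
    (D : rank_decomposition V) (s t : node D) : edge s t ->
  conn (mat_chain A) (edge_side s t) <= decomposition_width A D.
Proof.
move=> est; apply: leq_trans (conn_mat_chain A _) _.
have ets : edge t s by have [_ sym _ _ _] := edge_tree D; rewrite sym.
have -> : ~: edge_side s t = edge_side t s.
  apply/setP => v.
  have : (leaf D v \in component (@edge V D) t s) = (leaf D v \notin component (@edge V D) s t).
    by rewrite (componentC (edge_tree D) est) in_setC.
  by rewrite in_setC !edge_sideE // !in_set.
exact: (leq_bigmax_cond (s, t)).
Qed.

Lemma bounded_representation (F : fieldType) (V : finType) (Fs : {set {set V}}) w k :
    branch_width F Fs w -> w <= k ->
  exists A : V -> V -> F, represents A Fs /\ exists T : dtree V,
    [/\ dvalid T, dset T = setT, all (fun X => conn (mat_chain A) X <= k) (dsets T) &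
    forall C D tf, T = plug C (plug D tf) ->
      all (fun X => conn (mat_chain A) (dset tf) <= conn (mat_chain A) X) (path_sets D tf) ->
      forall Z : {set V}, dset tf \subset Z -> Z \subset dset (plug D tf) ->
      conn (mat_chain A) (dset tf) <= conn (mat_chain A) Z].
Proof.
move=> [[A repA rwA] _] wk; exists A; split=> //.
have lagA := mat_chain_lagrangian repA.1.
(* The rooted tree carries [setT] at its root, a set whose value the decomposition does not
   bound. *)
have connT : conn (mat_chain A) setT = 0 by rewrite -setC0 connC // conn0.
suff [t0 [v0 d0 w0]] : exists t, [/\ dvalid t, dset t = setT &
    all (fun X => conn (mat_chain A) X <= k) (dsets t)].
  rewrite -d0; apply: linked_tree v0 w0.
  - exact: conn0.
  - by move=> X; apply: connC.
  - by move=> X Y; apply: conn_submod.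
move: rwA; rewrite /rank_width; case: leqP => [cV _|cV [[D wD] _]].
  by exists (DLeaf setT); rewrite /= cardsT cV connT.
apply: (@decomposition_dtree _ D) => //; last by rewrite connT.
by move=> s t est; apply: leq_trans (conn_edge_side A est) _; rewrite wD.
Qed.

Theorem theorem7p3 (F : finFieldType) (k : nat) (V : nat -> finType)
    (M : forall i : nat, {set {set V i}})
    (dmM : forall i, delta_matroid (M i))
    (reprM : forall i, representable F (M i))
    (bwM : forall i, exists2 w, branch_width F (M i) w & w <= k) :
  exists i j : nat, i < j /\
    exists (U : finType) (N : {set {set U}}),
      minor (M j) N /\ isomorphic (M i) N.
Proof.
have H i := let: ex_intro2 w bw wk := bwM i in bounded_representation bw wk.
pose A i := sval (cid (H i)).
have repA i : represents (A i) (M i) by case: (svalP (cid (H i))).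
have HT i := (svalP (cid (H i))).2.
pose T i := sval (cid (HT i)).
have TP i := svalP (cid (HT i)).
have [||||i [j [ij leij]]] := @forest_good F V k (fun i => mat_chain (A i)) T.
- by move=> i; apply: mat_chain_lagrangian; case: (repA i).
- by move=> i; case: (TP i).
- by move=> i; case: (TP i).
- by move=> i; case: (TP i).
exists i, j; split=> //.
have [_ dTi _ _] := TP i; have [_ dTj _ _] := TP j; rewrite dTi dTj in leij.
have [M0 _] := dmM i; have [_ eqi] := repA i; have [symj eqj] := repA j.
exact (isomorphic_minor symj M0 eqi eqj leij).
Qed.
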